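(* Let $\mathbb{K}$ be a field, let $q\in\mathbb{K}^*$ be not a root of unity, and let $A_{\alpha,\beta}=U_q^+(G_2)/\langle\Omega_1-\alpha,\Omega_2-\beta\rangle$. Then the Gelfand–Kirillov dimension of $A_{\alpha,\beta}$ is $4$ for all $(\alpha,\beta)\in\mathbb{K}^2$ with $(\alpha,\beta)\neq(0,0)$.
   Context: $A=U_q^+(G_2)$ is the $\mathbb{K}$-algebra generated by $E_1,\dots,E_6$ with defining relations \begin{align*} &E_2E_1=q^{-3}E_1E_2,\quad E_3E_1=q^{-1}E_1E_3-(q+q^{-1}+q^{-3})E_2,\quad E_3E_2=q^{-3}E_2E_3,\\ &E_4E_1=E_1E_4+(1-q^2)E_3^2,\quad E_4E_2=q^{-3}E_2E_4-\tfrac{q^4-2q^2+1}{q^4+q^2+1}E_3^3,\quad E_4E_3=q^{-3}E_3E_4,\\ &E_5E_1=qE_1E_5-(1+q^2)E_3,\quad E_5E_2=E_2E_5+(1-q^2)E_3^2,\\ &E_5E_3=q^{-1}E_3E_5-(q+q^{-1}+q^{-3})E_4,\quad E_5E_4=q^{-3}E_4E_5,\\ &E_6E_1=q^3E_1E_6-q^3E_5,\quad E_6E_2=q^3E_2E_6+(q^4+q^2-1)E_4+(q^2-q^4)E_3E_5,\\ &E_6E_3=E_3E_6+(1-q^2)E_5^2,\quad E_6E_4=q^{-3}E_4E_6-\tfrac{q^4-2q^2+1}{q^4+q^2+1}E_5^3,\quad E_6E_5=q^{-3}E_5E_6. \end{align*} It is a noetherian domain and the monomials $E_1^{k_1}\cdots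 E_6^{k_6}$ ($k_i\in\mathbb{N}$) form a $\mathbb{K}$-basis. Define the central elements \begin{align*} \Omega_1&=E_1E_3E_5+aE_1E_4+aE_2E_5+a'E_3^2,\\ \Omega_2&=E_2E_4E_6+bE_2E_5^3+bE_3^3E_6+b'E_3^2E_5^2+c'E_3E_4E_5+d'E_4^2, \end{align*} where $a=\frac{q^2+1+q^{-2}}{q^{-2}-1}$, $a'=\frac{q^6}{q^2-1}$, $b=-\frac{q^7-2q^5+q^3}{(q^4+q^2+1)(1-q^{-6})}$, $b'=\frac{q^{13}-q^{11}}{(q^4+q^2+1)^2}$, $c'=-\frac{q^9}{q^4+q^2+1}$, $d'=\frac{q^{12}}{q^6-1}$. $\langle\cdot\rangle$ denotes the two-sided ideal generated. *)

(* Defs.v *)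
From HB Require Import structures.
From mathcomp Require Import all_boot all_order all_algebra.
From mathcomp Require Import generic_quotient monalg.
From mathcomp Require Import boolp classical_sets reals ereal sequences exp.

Set Implicit Arguments.
Unset Strict Implicit.
Unset Printing Implicit Defensive.

Import GRing.Theory.

Local Open Scope ring_scope.
Local Open Scope quotient_scope.
Local Open Scope classical_set_scope.

(* A K-algebra is a ring A together with a ring morphism from K to the centre
   of A.  MathComp's algType is not used because it requires 1 != 0 in A, which
   is not known beforehand for the quotient algebras constructed below. *)
HB.mixin Record PzRing_isPzAlgebra (K : fieldType) A of GRing.PzRing A := {
  pzscalar : {rmorphism K -> A};
  pzscalarC : forall (c : K) (x : A), pzscalar c * x = x * pzscalar c
}.

#[short(type="pzAlgType")]
HB.structure Definition PzAlgebra (K : fieldType) :=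
  { A of GRing.PzRing A & PzRing_isPzAlgebra K A }.

Reserved Notation "c %:S" (at level 1, format "c %:S").
Notation "c %:S" := (pzscalar c) : ring_scope.

Section MonoidAlgebra.
Variables (K : fieldType) (M : monomType).

Lemma malg_scalarC (c : K) (x : {malg K[M]}) :
  malgC c * x = x * malgC c.
Proof.
rewrite mul_malgC malgM_def fgmulgU malgZ_def.
by apply: eq_bigr => k _; rewrite mulm1 mulrC.
Qed.

HB.instance Definition _ :=
  PzRing_isPzAlgebra.Build K {malg K[M]} malg_scalarC.

End MonoidAlgebra.

Section QuotientAlgebra.
Variables (K : fieldType) (A : pzAlgType K).

(* Closure under multiplication by scalars is a special case of the last
   condition. *)
Definition is_ideal (I : set A) : Prop :=
  [/\ I 0, forall x y, I x -> I y -> I (x - y)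
    & forall a x b, I x -> I (a * x * b)].

Definition ideal_gen (S : set A) : set A := smallest is_ideal S.

Variable S : set A.

Lemma ideal_genP : is_ideal (ideal_gen S).
Proof.
split=> [|x y Sx Sy|a x b Sx] I [Iideal SI].
- by case: Iideal.
- by case: (Iideal) => _ IB _; apply: IB; [apply: Sx|apply: Sy].
- by case: (Iideal) => _ _ IM; apply: IM; apply: Sx.
Qed.

Let I0 : ideal_gen S 0. Proof. by case: ideal_genP. Qed.
Let IB x y : ideal_gen S x -> ideal_gen S y -> ideal_gen S (x - y).
Proof. by case: ideal_genP => _ h _; apply: h. Qed.
Let IN x : ideal_gen S x -> ideal_gen S (- x).
Proof. by rewrite -sub0r; apply: IB. Qed.
Let ID x y : ideal_gen S x -> ideal_gen S y -> ideal_gen S (x + y).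
Proof. by move=> Ix Iy; rewrite -[y]opprK; apply: IB => //; apply: IN. Qed.
Let IM a x b : ideal_gen S x -> ideal_gen S (a * x * b).
Proof. by case: ideal_genP => _ _; apply. Qed.

Definition ideal_eqv (x y : A) : bool := `[< ideal_gen S (x - y) >].

Lemma ideal_eqv_is_equiv : equiv_class_of ideal_eqv.
Proof.
split=> [x|x y|y x z].
- by apply/asboolP; rewrite subrr.
- by apply: asbool_equiv_eq; split=> /IN; rewrite opprB.
- by move=> /asboolP xy /asboolP yz; apply/asboolP; rewrite -(subrKA y); apply: ID.
Qed.

Canonical ideal_eqv_equiv := EquivRelPack ideal_eqv_is_equiv.
Canonical ideal_eqv_encModRel := defaultEncModRel ideal_eqv.

Definition quotient_alg := {eq_quot ideal_eqv}.

HB.instance Definition _ : EqQuotient A ideal_eqv quotient_alg :=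
  EqQuotient.on quotient_alg.
HB.instance Definition _ := Choice.on quotient_alg.

Definition quotient_proj (x : A) : quotient_alg := \pi_quotient_alg x.

Lemma quotient_projP x y :
  quotient_proj x = quotient_proj y <-> ideal_gen S (x - y).
Proof.
split=> [/eqP|h]; first by rewrite piE => /asboolP.
by apply/eqP; rewrite piE; apply/asboolP.
Qed.

Let reprK' (x : quotient_alg) : quotient_proj (repr x) = x.
Proof. exact: reprK. Qed.

Let reprB x : ideal_gen S (repr (quotient_proj x) - x).
Proof. by apply/quotient_projP; rewrite reprK'. Qed.

Definition quotient_opp (x : quotient_alg) : quotient_alg :=
  quotient_proj (- repr x).
Definition quotient_add (x y : quotient_alg) : quotient_alg :=
  quotient_proj (repr x + repr y).
Definition quotient_mul (x y : quotient_alg) : quotient_alg :=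
  quotient_proj (repr x * repr y).

Let projN x : quotient_opp (quotient_proj x) = quotient_proj (- x).
Proof. by apply/quotient_projP; rewrite -opprD; apply: IN; apply: reprB. Qed.

Let projD x y :
  quotient_add (quotient_proj x) (quotient_proj y) = quotient_proj (x + y).
Proof.
by apply/quotient_projP; rewrite opprD addrACA; apply: ID; apply: reprB.
Qed.

Let projM x y :
  quotient_mul (quotient_proj x) (quotient_proj y) = quotient_proj (x * y).
Proof.
apply/quotient_projP; set x' := repr _; set y' := repr _.
have -> : x' * y' - x * y = 1 * (x' - x) * y' + x * (y' - y) * 1.
  by rewrite mul1r mulr1 mulrBl mulrBr addrA subrK.
by apply: ID; apply: IM; apply: reprB.
Qed.

Let projW (P : quotient_alg -> Prop) :
  (forall x, P (quotient_proj x)) -> forall x, P x.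
Proof. by move=> h x; rewrite -[x]reprK'; apply: h. Qed.

Let addqA : associative quotient_add.
Proof.
by elim/projW=> x; elim/projW=> y; elim/projW=> z; rewrite !projD addrA.
Qed.
Let addqC : commutative quotient_add.
Proof. by elim/projW=> x; elim/projW=> y; rewrite !projD addrC. Qed.
Let add0q : left_id (quotient_proj 0) quotient_add.
Proof. by elim/projW=> x; rewrite projD add0r. Qed.
Let addNq : left_inverse (quotient_proj 0) quotient_opp quotient_add.
Proof. by elim/projW=> x; rewrite projN projD addNr. Qed.

HB.instance Definition _ :=
  GRing.isZmodule.Build quotient_alg addqA addqC add0q addNq.

Let mulqA : associative quotient_mul.
Proof.
by elim/projW=> x; elim/projW=> y; elim/projW=> z; rewrite !projM mulrA.
Qed.
Let mul1q : left_id (quotient_proj 1) quotient_mul.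
Proof. by elim/projW=> x; rewrite projM mul1r. Qed.
Let mulq1 : right_id (quotient_proj 1) quotient_mul.
Proof. by elim/projW=> x; rewrite projM mulr1. Qed.
Let mulqDl : left_distributive quotient_mul quotient_add.
Proof.
elim/projW=> x; elim/projW=> y; elim/projW=> z.
by rewrite projD !projM projD mulrDl.
Qed.
Let mulqDr : right_distributive quotient_mul quotient_add.
Proof.
elim/projW=> x; elim/projW=> y; elim/projW=> z.
by rewrite projD !projM projD mulrDr.
Qed.

HB.instance Definition _ := GRing.Zmodule_isPzRing.Build quotient_alg
  mulqA mul1q mulq1 mulqDl mulqDr.

Let quotient_projB : zmod_morphism quotient_proj.
Proof. by move=> x y; rewrite -projD -projN. Qed.
Let quotient_projM : monoid_morphism quotient_proj.
Proof. by split=> // x y; rewrite -projM. Qed.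

HB.instance Definition _ :=
  GRing.isZmodMorphism.Build A quotient_alg quotient_proj quotient_projB.
HB.instance Definition _ :=
  GRing.isMonoidMorphism.Build A quotient_alg quotient_proj quotient_projM.

Let quotient_scalar : {rmorphism K -> quotient_alg} :=
  quotient_proj \o pzscalar.
Let quotient_scalarC (c : K) (x : quotient_alg) :
  quotient_scalar c * x = x * quotient_scalar c.
Proof. by elim/projW: x => x; rewrite /= -!(rmorphM quotient_proj) pzscalarC. Qed.

HB.instance Definition _ :=
  PzRing_isPzAlgebra.Build K quotient_alg quotient_scalarC.

End QuotientAlgebra.

Section GelfandKirillov.
Variables (R : realType) (K : fieldType) (A : pzAlgType K).

Definition is_subspace (V : set A) : Prop :=
  [/\ V 0, forall x y, V x -> V y -> V (x + y)
    & forall (c : K) x, V x -> V (c%:S * x)].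

Definition lin_span (X : set A) : set A := smallest is_subspace X.

Definition lin_indep (X : seq A) : Prop :=
  forall c : nat -> K, \sum_(i < size X) (c i)%:S * X`_i = 0 ->
    forall i, (i < size X)%N -> c i = 0.

Definition is_basis (V : set A) (X : seq A) : Prop :=
  lin_indep X /\ lin_span [set` X] = V.

(* The value is only meaningful for finite-dimensional V. *)
Definition subspace_dim (V : set A) : nat :=
  size (xget [::] [set X | is_basis V X]).

Definition fin_dim_subspace (V : set A) : Prop :=
  exists X : seq A, V = lin_span [set` X].

Fixpoint subspace_pow (V : set A) (n : nat) : set A :=
  if n is m.+1 then lin_span [set x * y | x in subspace_pow V m & y in V]
  else lin_span [set 1].

Definition growth (V : set A) (n : nat) : nat :=
  subspace_dim (lin_span (\bigcup_(i in [set i | (i <= n)%N]) subspace_pow V i)).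

(* The terms n = 0 and n = 1, where the quotient of logarithms is a division
   by 0, do not affect the upper limit. *)
Definition GKdim : \bar R :=
  ereal_sup
    [set limn_esup (fun n => (ln (growth V n)%:R / ln n%:R)%:E)
       | V in fin_dim_subspace].

End GelfandKirillov.

Section UqG2.
Variables (K : fieldType) (q : K).

(* The generator E_k of the free algebra, for 1 <= k <= 6. *)
Definition free_gen (k : nat) : {malg K[{fmonom 'I_6}]} :=
  << fmu (inord k.-1 : 'I_6) >>.

Local Notation e := free_gen.

Definition UqG2_relations : seq ({malg K[{fmonom 'I_6}]} * {malg K[{fmonom 'I_6}]}) :=
  let s := q + q^-1 + q ^- 3 in
  let t := (q ^+ 4 - 2 * q ^+ 2 + 1) / (q ^+ 4 + q ^+ 2 + 1) in
  [:: (e 2 * e 1, q ^- 3 *: (e 1 * e 2));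
      (e 3 * e 1, q^-1 *: (e 1 * e 3) - s *: e 2);
      (e 3 * e 2, q ^- 3 *: (e 2 * e 3));
      (e 4 * e 1, e 1 * e 4 + (1 - q ^+ 2) *: e 3 ^+ 2);
      (e 4 * e 2, q ^- 3 *: (e 2 * e 4) - t *: e 3 ^+ 3);
      (e 4 * e 3, q ^- 3 *: (e 3 * e 4));
      (e 5 * e 1, q *: (e 1 * e 5) - (1 + q ^+ 2) *: e 3);
      (e 5 * e 2, e 2 * e 5 + (1 - q ^+ 2) *: e 3 ^+ 2);
      (e 5 * e 3, q^-1 *: (e 3 * e 5) - s *: e 4);
      (e 5 * e 4, q ^- 3 *: (e 4 * e 5));
      (e 6 * e 1, q ^+ 3 *: (e 1 * e 6) - q ^+ 3 *: e 5);
      (e 6 * e 2, q ^+ 3 *: (e 2 * e 6) + (q ^+ 4 + q ^+ 2 - 1) *: e 4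
                  + (q ^+ 2 - q ^+ 4) *: (e 3 * e 5));
      (e 6 * e 3, e 3 * e 6 + (1 - q ^+ 2) *: e 5 ^+ 2);
      (e 6 * e 4, q ^- 3 *: (e 4 * e 6) - t *: e 5 ^+ 3);
      (e 6 * e 5, q ^- 3 *: (e 5 * e 6))].

Definition UqG2 : pzAlgType K :=
  quotient_alg [set r.1 - r.2 | r in [set` UqG2_relations]].

Definition UqG2_gen (k : nat) : UqG2 := quotient_proj _ (free_gen k).

Local Notation E := UqG2_gen.

Definition Omega1 : UqG2 :=
  let a := (q ^+ 2 + 1 + q ^- 2) / (q ^- 2 - 1) in
  let a' := q ^+ 6 / (q ^+ 2 - 1) in
  E 1 * E 3 * E 5 + a%:S * E 1 * E 4 + a%:S * E 2 * E 5 + a'%:S * E 3 ^+ 2.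

Definition Omega2 : UqG2 :=
  let d := q ^+ 4 + q ^+ 2 + 1 in
  let b := - ((q ^+ 7 - 2 * q ^+ 5 + q ^+ 3) / (d * (1 - q ^- 6))) in
  let b' := (q ^+ 13 - q ^+ 11) / d ^+ 2 in
  let c' := - (q ^+ 9 / d) in
  let d' := q ^+ 12 / (q ^+ 6 - 1) in
  E 2 * E 4 * E 6 + b%:S * E 2 * E 5 ^+ 3 + b%:S * E 3 ^+ 3 * E 6
  + b'%:S * E 3 ^+ 2 * E 5 ^+ 2 + c'%:S * E 3 * E 4 * E 5 + d'%:S * E 4 ^+ 2.

Definition A_alg (alpha beta : K) : pzAlgType K :=
  quotient_alg [set Omega1 - alpha%:S; Omega2 - beta%:S].

End UqG2.

(* Main.v *)
Require Import Defs.
From HB Require Import structures.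
From mathcomp Require Import all_boot all_order all_algebra.
From mathcomp Require Import generic_quotient monalg.
From mathcomp Require Import boolp classical_sets reals ereal topology.
From mathcomp Require Import normedtype sequences exp.
From mathcomp Require Import ring zify.

(* Give the generators E_1, ..., E_6 the weights 4, 4, 2, 3, 2, 4.  Modulo words
   of smaller weight all letters q-commute, and E_1 E_3 E_5 (by Omega_1 = alpha)
   and E_2 E_4 E_6 (by Omega_2 = beta) vanish.  Hence words of weight at most n
   are spanned by ordered monomials in which one of E_1, E_3, E_5 and one of
   E_2, E_4, E_6 do not occur: 9 (n + 1)^4 elements.

   For the lower bound, E_1, E_2, u_3 = E_1 E_3 + a E_2 and
   u_4 = E_2 E_4 + b E_3^3 q-commute with one another.  Solving these equations
   for E_3 and E_4, then Omega_1 = alpha for E_5 and Omega_2 = beta for E_6,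
   expresses the generators as Laurent polynomials in a quantum torus of rank 4.
   All relations hold there, for every alpha and beta, so the monomials in
   E_1, E_2, u_3, u_4 are linearly independent in the quotient algebra.  The
   torus acts on functions on Z^4 by shifts, and the relations are checked by
   computing with Laurent polynomials in q with integer coefficients. *)

Set Implicit Arguments.
Unset Strict Implicit.
Unset Printing Implicit Defensive.

Import Order.TTheory GRing.Theory Num.Theory.
Import numFieldNormedType.Exports.

Local Open Scope ring_scope.

(** * Linear algebra in K-algebras *)

Section LinSpan.
Local Open Scope classical_set_scope.
Variables (K : fieldType) (A : pzAlgType K).
Implicit Types (S V W : set A) (X Y : seq A).

Lemma lin_span_subspace S : is_subspace (lin_span S).
Proof.
split=> [|x y Sx Sy|c x Sx] V [Vsub SV].
- by case: Vsub.
- by case: (Vsub) => _ VD _; apply: VD; [apply: Sx|apply: Sy].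
- by case: (Vsub) => _ _ VZ; apply: VZ; apply: Sx.
Qed.

Lemma sub_lin_span S : S `<=` lin_span S.
Proof. by move=> x Sx V [_]; apply. Qed.

Lemma lin_span_min S V : is_subspace V -> S `<=` V -> lin_span S `<=` V.
Proof. by move=> Vsub SV x; apply; split. Qed.

Lemma lin_span_sum S (I : Type) (r : seq I) (P : pred I) (F : I -> A) :
  (forall i, P i -> lin_span S (F i)) ->
  lin_span S (\sum_(i <- r | P i) F i).
Proof. by have [S0 SD _] := lin_span_subspace S; apply: big_ind. Qed.

Lemma lin_span_seqP X x :
  lin_span [set` X] x <->
  exists c : nat -> K, x = \sum_(i < size X) (c i)%:S * X`_i.
Proof.
split=> [|[c ->]]; last first.
  apply: lin_span_sum => i _; have [_ _ SZ] := lin_span_subspace [set` X].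
  by apply: SZ; apply: sub_lin_span; apply: mem_nth.
move: x; apply: lin_span_min; first split.
- by exists (fun=> 0); rewrite big1 // => i _; rewrite rmorph0 mul0r.
- move=> _ _ [c ->] [d ->]; exists (fun i => c i + d i).
  by rewrite -big_split /=; apply: eq_bigr => i _; rewrite rmorphD mulrDl.
- move=> c _ [d ->]; exists (fun i => c * d i).
  by rewrite mulr_sumr; apply: eq_bigr => i _; rewrite rmorphM mulrA.
move=> x /= xX; have ltxX: (index x X < size X)%N by rewrite index_mem.
exists (fun i => (i == index x X)%:R).
rewrite (bigD1 (Ordinal ltxX)) //= eqxx rmorph1 mul1r nth_index //.
rewrite big1 ?addr0 //.
by move=> i /negPf; rewrite -val_eqE /= => ->; rewrite rmorph0 mul0r.
Qed.

(** Steinitz bound: with more vectors than spanning elements, the coefficient matrix [M] has more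
    rows than columns, so a nonzero row vector annihilates it and gives a nontrivial relation. *)
Lemma lin_indep_size_le X Y :
  lin_indep Y -> [set` Y] `<=` lin_span [set` X] -> (size Y <= size X)%N.
Proof.
move=> Yind YX; rewrite leqNgt; apply/negP => ltXY.
have /choice[c cP] (j : 'I_(size Y)) : exists c : nat -> K,
    Y`_j = \sum_(i < size X) (c i)%:S * X`_i.
  by apply/lin_span_seqP; apply: YX; apply: mem_nth.
pose M : 'M[K]_(size Y, size X) := \matrix_(j, i) c j i.
have kerM : kermx M != 0.
  rewrite -mxrank_eq0 mxrank_ker subn_eq0 -ltnNge.
  exact: leq_ltn_trans (rank_leq_col M) ltXY.
have /rowV0Pn[v /sub_kermxP vM v0] := kerM.
(* [lin_indep] takes coefficients indexed by all naturals, so [v] is extended by 0. *)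
pose d (j : nat) := if insub j is Some j' then v 0 j' else 0.
have dE (j : 'I_(size Y)) : d j = v 0 j by rewrite /d valK.
have dY : \sum_(j < size Y) (d j)%:S * Y`_j = 0.
  transitivity (\sum_(i < size X) ((v *m M) 0 i)%:S * X`_i); last first.
    by rewrite vM big1 // => i _; rewrite mxE rmorph0 mul0r.
  under eq_bigr do rewrite cP mulr_sumr.
  rewrite exchange_big /=; apply: eq_bigr => i _.
  rewrite mxE rmorph_sum mulr_suml; apply: eq_bigr => j _.
  by rewrite mxE dE mulrA rmorphM.
case/negP: v0; apply/eqP/rowP => j; rewrite mxE -dE.
exact: Yind dY _ (ltn_ord j).
Qed.

Lemma lin_indep_cons Y x :
  lin_indep Y -> ~ lin_span [set` Y] x -> lin_indep (x :: Y).
Proof.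
move=> Yind xY c; rewrite big_ord_recl /= => c0.
have [_ _ SZ] := lin_span_subspace [set` Y].
have c00 : c 0%N = 0.
  apply/eqP/negP => /negP cn0; case: xY.
  have -> : x = (- (c 0%N)^-1)%:S *
     \sum_(i < size Y) (c i.+1)%:S * Y`_i.
    move/eqP: c0; rewrite addrC addr_eq0 => /eqP ->.
    by rewrite mulrN rmorphN mulNr opprK mulrA -rmorphM mulVf // rmorph1 mul1r.
  by apply: SZ; apply/lin_span_seqP; exists (fun i => c i.+1).
move: c0; rewrite c00 rmorph0 mul0r add0r => /(Yind (fun i => c i.+1)) cY.
by case=> // i; apply: cY.
Qed.

(** An independent family in [W] of maximal length is a basis: [lin_indep_size_le] bounds the
    lengths, and a vector outside the span could be prepended. *)
Lemma subspace_basis X W :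
  is_subspace W -> W `<=` lin_span [set` X] -> exists Y, is_basis W Y.
Proof.
move=> Wsub WX.
pose P n := `[< exists Y, [/\ lin_indep Y, [set` Y] `<=` W & size Y = n] >].
have exP : exists n, P n.
  by exists 0%N; apply/asboolP; exists [::]; split=> // c _ i.
have ubP n : P n -> (n <= size X)%N.
  move=> /asboolP[Y [Yind YW <-]]; apply: lin_indep_size_le Yind _.
  exact: subset_trans YW WX.
case: (ex_maxnP exP ubP) => n /asboolP[Y [Yind YW sY]] maxn.
exists Y; split=> //; apply/seteqP; split; first exact: lin_span_min.
move=> x Wx; apply: contrapT => xY.
have /maxn : P n.+1.
  apply/asboolP; exists (x :: Y); split; last by rewrite /= sY.
  - exact: lin_indep_cons.
  - by move=> y; rewrite /= inE => /predU1P[->|/YW].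
by rewrite ltnn.
Qed.

(** A basis of [W] is an independent family in the span of [X]; when there is none, the default
    [[::]] has size 0. *)
Lemma subspace_dim_le X W : W `<=` lin_span [set` X] ->
  (subspace_dim W <= size X)%N.
Proof.
move=> WX; rewrite /subspace_dim; case: xgetP => [Y _ [Yind YW]|//].
apply: lin_indep_size_le Yind _; apply: subset_trans WX.
by rewrite -YW; apply: sub_lin_span.
Qed.

(** For a lower bound the default value of [xget] has to be excluded, which [subspace_basis]
    does. *)
Lemma subspace_dim_ge X Y W :
    is_subspace W -> W `<=` lin_span [set` X] ->
  lin_indep Y -> [set` Y] `<=` W -> (size Y <= subspace_dim W)%N.
Proof.
move=> Wsub /(subspace_basis Wsub)[Z ZP] Yind YW; rewrite /subspace_dim.
case: xgetP => [B _ [_ BW]|/(_ Z)//].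
by apply: lin_indep_size_le Yind _; rewrite BW.
Qed.

End LinSpan.

Section ScalarMultiples.
Variables (K : fieldType) (A : pzAlgType K).
Implicit Types (c : K) (x y : A).

Lemma scalarA c c' x : c%:S * (c'%:S * x) = (c * c')%:S * x.
Proof. by rewrite rmorphM mulrA. Qed.

Lemma scalarMr c x y : x * (c%:S * y) = c%:S * (x * y).
Proof. by rewrite !mulrA pzscalarC. Qed.

Lemma scalarMl c x y : (c%:S * x) * y = c%:S * (x * y).
Proof. by rewrite mulrA. Qed.

Lemma scalarMM c c' x y : (c%:S * x) * (c'%:S * y) = (c * c')%:S * (x * y).
Proof. by rewrite -mulrA scalarMr scalarA. Qed.

Lemma scalarX c x n : (c%:S * x) ^+ n = (c ^+ n)%:S * x ^+ n.
Proof. by rewrite exprMn_comm ?rmorphXn //; apply: pzscalarC. Qed.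

Lemma scalarN c x : - (c%:S * x) = (- c)%:S * x.
Proof. by rewrite rmorphN mulNr. Qed.

End ScalarMultiples.

(** * Growth exponents as upper limits *)

Section GrowthExponent.
Local Open Scope classical_set_scope.
Variable R : realType.

Lemma limn_esup_le (u v : (\bar R)^nat) (N : nat) :
  (forall n, (N <= n)%N -> (u n <= v n)%E) -> (limn_esup u <= limn_esup v)%E.
Proof.
move=> uv; rewrite !limn_esup_lim; apply: lee_lim; try exact: is_cvg_esups.
near=> n; apply: ge_ereal_sup => _ [k /= lenk <-].
apply: (@le_trans _ _ (v k)).
  by apply: uv; apply: leq_trans lenk; near: n; exists N.
by apply: ereal_sup_ubound; exists k.
Unshelve. all: by end_near. Qed.

Lemma cvg_ln_nat : (ln (n%:R : R)) @[n --> \oo] --> +oo.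
Proof.
apply/cvgryPge => A; near=> n.
have le_expA : expR A <= n%:R.
  by near: n; move: (expR A); apply/cvgryPge; exact: cvgr_idn.
by rewrite -[A]expRK ler_ln ?posrE ?expR_gt0 // (lt_le_trans (expR_gt0 A)).
Unshelve. all: by end_near. Qed.

(** With c = ln C this is the growth exponent of C n^a: a constant factor does not change it. *)
Lemma limn_esup_ln_ratio (a : nat) (c : R) :
  limn_esup (fun n => (a%:R + c / ln n%:R)%:E) = a%:R%:E.
Proof.
apply: (cvg_limn_einf_sup _).2; apply: cvg_EFin; first by apply: nearW.
rewrite -[X in _ --> X]addr0; apply: cvgD; first exact: cvg_cst.
rewrite -[X in _ --> X](mulr0 c); apply: cvgM; first exact: cvg_cst.
apply/gtr0_cvgV0; last exact: cvg_ln_nat.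
by near=> n; apply: ln_gt0; rewrite ltr1n; near: n; exists 2%N.
Unshelve. all: by end_near. Qed.

Variables (g : nat -> nat) (a C : nat).
Hypothesis C_gt0 : (0 < C)%N.

Lemma limn_esup_growth_le :
  (forall n, (0 < n)%N -> (g n <= C * n ^ a)%N) ->
  (limn_esup (fun n => (ln (g n)%:R / ln n%:R)%:E) <= (a%:R : R)%:E)%E.
Proof.
move=> g_le; rewrite -(limn_esup_ln_ratio a (ln C%:R)).
(* From 2 on, [ln n] is positive and can be cleared from the denominator. *)
apply: (@limn_esup_le _ _ 2) => n n_ge2; rewrite lee_fin.
have n_gt0 : (0 < n)%N by apply: leq_trans n_ge2.
have ln_n : 0 < ln (n%:R : R) by rewrite ln_gt0 // ltr1n.
rewrite ler_pdivrMr // mulrDl divfK ?gt_eqF //.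
have -> : a%:R * ln n%:R + ln C%:R = ln ((C * n ^ a)%:R : R).
  rewrite natrM natrX lnM ?posrE ?exprn_gt0 ?ltr0n // lnXn ?ltr0n //.
  by rewrite addrC mulr_natl.
(* When [g n] is 0, the convention ln 0 = 0 leaves only a nonnegative right-hand side to check. *)
have [g0|g_gt0] := posnP (g n).
  by rewrite g0 ln0 // ln_ge0 // ler1n muln_gt0 C_gt0 expn_gt0 n_gt0.
rewrite ler_ln ?posrE ?ltr0n ?muln_gt0 ?C_gt0 ?expn_gt0 ?n_gt0 //.
by rewrite ler_nat g_le.
Qed.

Lemma limn_esup_growth_ge :
  (forall n, (0 < n)%N -> (n ^ a <= C * g n)%N) ->
  ((a%:R : R)%:E <= limn_esup (fun n => (ln (g n)%:R / ln n%:R)%:E))%E.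
Proof.
move=> g_ge; rewrite -(limn_esup_ln_ratio a (- ln C%:R)).
apply: (@limn_esup_le _ _ 2) => n n_ge2; rewrite lee_fin.
have n_gt0 : (0 < n)%N by apply: leq_trans n_ge2.
have ln_n : 0 < ln (n%:R : R) by rewrite ln_gt0 // ltr1n.
have g_gt0 : (0 < g n)%N.
  have : (0 < C * g n)%N.
    by apply: leq_trans (g_ge _ n_gt0); rewrite expn_gt0 n_gt0.
  by rewrite muln_gt0 C_gt0.
rewrite ler_pdivlMr // mulrDl divfK ?gt_eqF // lerBlDl -lnM ?posrE ?ltr0n //.
rewrite -natrM mulr_natl -lnXn ?ltr0n // -natrX.
rewrite ler_ln ?posrE ?ltr0n ?muln_gt0 ?C_gt0 ?expn_gt0 ?n_gt0 //.
by rewrite ler_nat g_ge.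
Qed.

End GrowthExponent.

(** * The defining relations *)

Section RelationsIn.
Variables (K : fieldType) (q : K) (A : pzAlgType K) (e : nat -> A).

(** Stated for any family in any algebra, so that one list serves the free algebra, both quotients
    and the torus, and can be carried along morphisms. *)
Definition g2_relations : seq (A * A) :=
  let s := q + q^-1 + q ^- 3 in
  let t := (q ^+ 4 - 2 * q ^+ 2 + 1) / (q ^+ 4 + q ^+ 2 + 1) in
  [:: (e 2 * e 1, (q ^- 3)%:S * (e 1 * e 2));
      (e 3 * e 1, q^-1%:S * (e 1 * e 3) - s%:S * e 2);
      (e 3 * e 2, (q ^- 3)%:S * (e 2 * e 3));
      (e 4 * e 1, e 1 * e 4 + (1 - q ^+ 2)%:S * e 3 ^+ 2);
      (e 4 * e 2, (q ^- 3)%:S * (e 2 * e 4) - t%:S * e 3 ^+ 3);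
      (e 4 * e 3, (q ^- 3)%:S * (e 3 * e 4));
      (e 5 * e 1, q%:S * (e 1 * e 5) - (1 + q ^+ 2)%:S * e 3);
      (e 5 * e 2, e 2 * e 5 + (1 - q ^+ 2)%:S * e 3 ^+ 2);
      (e 5 * e 3, q^-1%:S * (e 3 * e 5) - s%:S * e 4);
      (e 5 * e 4, (q ^- 3)%:S * (e 4 * e 5));
      (e 6 * e 1, (q ^+ 3)%:S * (e 1 * e 6) - (q ^+ 3)%:S * e 5);
      (e 6 * e 2, (q ^+ 3)%:S * (e 2 * e 6) + (q ^+ 4 + q ^+ 2 - 1)%:S * e 4
                  + (q ^+ 2 - q ^+ 4)%:S * (e 3 * e 5));
      (e 6 * e 3, e 3 * e 6 + (1 - q ^+ 2)%:S * e 5 ^+ 2);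
      (e 6 * e 4, (q ^- 3)%:S * (e 4 * e 6) - t%:S * e 5 ^+ 3);
      (e 6 * e 5, (q ^- 3)%:S * (e 5 * e 6))].

Definition g2_Omega1 : A :=
  let a := (q ^+ 2 + 1 + q ^- 2) / (q ^- 2 - 1) in
  let a' := q ^+ 6 / (q ^+ 2 - 1) in
  e 1 * e 3 * e 5 + a%:S * e 1 * e 4 + a%:S * e 2 * e 5 + a'%:S * e 3 ^+ 2.

Definition g2_Omega2 : A :=
  let d := q ^+ 4 + q ^+ 2 + 1 in
  let b := - ((q ^+ 7 - 2 * q ^+ 5 + q ^+ 3) / (d * (1 - q ^- 6))) in
  let b' := (q ^+ 13 - q ^+ 11) / d ^+ 2 in
  let c' := - (q ^+ 9 / d) in
  let d' := q ^+ 12 / (q ^+ 6 - 1) in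
  e 2 * e 4 * e 6 + b%:S * e 2 * e 5 ^+ 3 + b%:S * e 3 ^+ 3 * e 6
  + b'%:S * e 3 ^+ 2 * e 5 ^+ 2 + c'%:S * e 3 * e 4 * e 5 + d'%:S * e 4 ^+ 2.

End RelationsIn.

(** * Universal property of quotient algebras *)

Section QuotientLift.
Local Open Scope quotient_scope.
Local Open Scope classical_set_scope.
Variables (K : fieldType) (A : pzAlgType K) (B : pzRingType).
Variables (S : set A) (f : {rmorphism A -> B}).
Hypothesis fS : forall x, S x -> f x = 0.

(** The kernel of [f] is an ideal containing [S], and [ideal_gen S] is the smallest such ideal. *)
Lemma ideal_gen_ker x : ideal_gen S x -> f x = 0.
Proof.
move=> /(_ [set y | f y = 0]); apply; split; last exact: fS.
split=> [|y z fy fz|y z t fz]; rewrite /= ?rmorph0 //.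
  by rewrite rmorphB fy fz subrr.
by rewrite !rmorphM fz mulr0 mul0r.
Qed.

Lemma quotient_proj_surj (x : quotient_alg S) : exists y, x = quotient_proj S y.
Proof. by exists (repr x); rewrite /quotient_proj reprK. Qed.

Lemma quotient_lift : exists g : {rmorphism quotient_alg S -> B},
  forall x, g (quotient_proj S x) = f x.
Proof.
(* Evaluation at a chosen representative; by [ideal_gen_ker] the choice does not matter. *)
pose g (x : quotient_alg S) := f (repr x).
have gE x : g (quotient_proj S x) = f x.
  apply/eqP; rewrite -subr_eq0 -rmorphB; apply/eqP/ideal_gen_ker.
  by apply/quotient_projP; rewrite /quotient_proj reprK.
have gB : zmod_morphism g.
  move=> x y; have [x' ->] := quotient_proj_surj x.
  have [y' ->] := quotient_proj_surj y.
  by rewrite -rmorphB !gE rmorphB.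
have gM : monoid_morphism g.
  split=> [|x y]; first by rewrite -(rmorph1 (quotient_proj S)) gE rmorph1.
  have [x' ->] := quotient_proj_surj x; have [y' ->] := quotient_proj_surj y.
  by rewrite -rmorphM !gE rmorphM.
pose G : {rmorphism quotient_alg S -> B} := HB.pack g
  (GRing.isZmodMorphism.Build _ _ g gB) (GRing.isMonoidMorphism.Build _ _ g gM).
by exists G.
Qed.

End QuotientLift.

(** * The relations in the two quotient algebras *)

Section AlgebraMorphisms.
Local Open Scope classical_set_scope.
Variables (K : fieldType) (q : K).

Lemma UqG2_relationsE : UqG2_relations q = g2_relations q (@free_gen K).
Proof.
(* Rewriting in {malg K[_]} is slow, hence the syntax-directed proof. *)
have scalarE c (x : {malg K[{fmonom 'I_6}]}) : c *: x = c%:S * x.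
  by rewrite -mul_malgC.
rewrite /UqG2_relations /g2_relations; cbv zeta.
repeat lazymatch goal with
  | |- _ :: _ = _ => apply: (f_equal2 (@cons _))
  | |- (_, _) = _ => apply: (f_equal2 pair)
  | |- _ *: _ = _ => apply: scalarE
  | |- _ + _ = _ => apply: (f_equal2 +%R)
  | |- - _ = _ => apply: (f_equal -%R)
  | |- _ => reflexivity
  end.
Qed.

Lemma map_g2_Omega (A B : pzAlgType K) (f : {rmorphism A -> B}) (e : nat -> A) :
  (forall c, f c%:S = c%:S) ->
  (f (g2_Omega1 q e) = g2_Omega1 q (f \o e)) *
  (f (g2_Omega2 q e) = g2_Omega2 q (f \o e)).
Proof.
move=> fS; rewrite /g2_Omega1 /g2_Omega2.
by split; rewrite !(rmorphD f, rmorphM f, rmorphXn f, fS).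
Qed.

Lemma map_g2_relations (A B : pzAlgType K) (f : {rmorphism A -> B})
    (e : nat -> A) :
  (forall c, f c%:S = c%:S) ->
  [seq (f r.1, f r.2) | r <- g2_relations q e] = g2_relations q (f \o e).
Proof.
by move=> fS; rewrite /g2_relations; cbn [map fst snd];
  rewrite !(rmorphB f, rmorphD f, rmorphM f, rmorphXn f, fS).
Qed.

Lemma UqG2_genP r : r \in g2_relations q (UqG2_gen q) -> r.1 = r.2.
Proof.
rewrite -[UqG2_gen q]/(quotient_proj _ \o @free_gen K).
rewrite -map_g2_relations // -UqG2_relationsE => /mapP[s sR ->] /=.
by apply/quotient_projP => I [_]; apply; exists s.
Qed.

Variables alpha beta : K.
Definition A_gen (k : nat) : A_alg q alpha beta :=
  quotient_proj _ (UqG2_gen q k).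

Lemma A_genP r : r \in g2_relations q A_gen -> r.1 = r.2.
Proof.
rewrite -[A_gen]/(quotient_proj _ \o UqG2_gen q).
by rewrite -map_g2_relations // => /mapP[s sR ->] /=; rewrite (UqG2_genP sR).
Qed.

Lemma A_Omega1 : g2_Omega1 q A_gen = alpha%:S.
Proof.
rewrite -[A_gen]/(quotient_proj _ \o UqG2_gen q) -(map_g2_Omega _ _).1 //.
by apply/quotient_projP => I [_]; apply; left.
Qed.

Lemma A_Omega2 : g2_Omega2 q A_gen = beta%:S.
Proof.
rewrite -[A_gen]/(quotient_proj _ \o UqG2_gen q) -(map_g2_Omega _ _).2 //.
by apply/quotient_projP => I [_]; apply; right.
Qed.

End AlgebraMorphisms.

(** * Upper bound: straightening *)

Section Straightening.
Local Open Scope classical_set_scope.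
Variables (K : fieldType) (q : K).
Hypothesis q_neq0 : q != 0.
Variables (alpha beta : K) (A : pzAlgType K) (e : nat -> A).
Hypothesis e_rel : forall r, r \in g2_relations q e -> r.1 = r.2.
Hypothesis e_Omega1 : g2_Omega1 q e = alpha%:S.
Hypothesis e_Omega2 : g2_Omega2 q e = beta%:S.

(* The letter i : 'I_6 stands for E_(i+1).  These weights make every term of a
   relation except E_i E_j and E_j E_i, every term of Omega_1 except
   E_1 E_3 E_5, and every term of Omega_2 except E_2 E_4 E_6, strictly lower. *)
Definition letter_weight (i : 'I_6) : nat := nth 0%N [:: 4; 4; 2; 3; 2; 4]%N i.
Definition weight (s : seq 'I_6) : nat := sumn (map letter_weight s).
Definition word (s : seq 'I_6) : A := \prod_(i <- s) e i.+1.

Lemma weight_cat s t : weight (s ++ t) = (weight s + weight t)%N.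
Proof. by rewrite /weight map_cat sumn_cat. Qed.

Lemma weight_perm s t : perm_eq s t -> weight s = weight t.
Proof. by move=> st; rewrite /weight; apply/perm_sumn/perm_map. Qed.

Lemma size_le_weight s : (size s <= weight s)%N.
Proof.
have w_gt0 i : (0 < letter_weight i)%N by case: i => [[|[|[|[|[|[|//]]]]]] ?].
elim: s => //= i s IHs; exact: leq_add (w_gt0 i) IHs.
Qed.

Lemma word_cat s t : word (s ++ t) = word s * word t.
Proof. by rewrite /word big_cat. Qed.

Lemma word_cons i s : word (i :: s) = e i.+1 * word s.
Proof. by rewrite /word big_cons. Qed.

(** The weight filtration with a strict bound: [below (weight s)] holds the terms of lower order
    than [word s], and [below n.+1] is the piece of weight at most [n]. *)
Definition below (n : nat) : set A :=
  lin_span [set word s | s in [set s | (weight s < n)%N]].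

Lemma below_word n s : (weight s < n)%N -> below n (word s).
Proof. by move=> ltsn; apply: sub_lin_span; exists s. Qed.

Lemma below_eq s n y : word s = y -> (weight s < n)%N -> below n y.
Proof. by move=> <-; apply: below_word. Qed.

Lemma below_subspace n : is_subspace (below n).
Proof. exact: lin_span_subspace. Qed.

Lemma below0 n : below n 0.
Proof. by case: (below_subspace n). Qed.

Lemma belowD n x y : below n x -> below n y -> below n (x + y).
Proof. by case: (below_subspace n) => _ h _; apply: h. Qed.

Lemma belowZ n c x : below n x -> below n (c%:S * x).
Proof. by case: (below_subspace n) => _ _; apply. Qed.

Lemma belowN n x : below n x -> below n (- x).
Proof. by move=> /(belowZ (-1)); rewrite rmorphN1 mulN1r. Qed.

Lemma belowB n x y : below n x -> below n y -> below n (x - y).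
Proof. by move=> nx /belowN; apply: belowD. Qed.

Lemma below_cat s n t x :
  below n x -> below (weight s + n + weight t) (word s * x * word t).
Proof.
move: x; apply: lin_span_min => [|_ [u ltun <-]].
  split=> [|x y|c x]; rewrite /= ?mulr0 ?mul0r ?mulrDr ?mulrDl.
  - exact: below0.
  - exact: belowD.
  - by rewrite scalarMr scalarMl; apply: belowZ.
rewrite /= -!word_cat; apply: below_word.
by rewrite !weight_cat ltn_add2r ltn_add2l.
Qed.

(** For words of equal weight: in the associated graded space, the class of [word s] is a multiple
    of that of [word t]. *)
Definition equiv (s t : seq 'I_6) : Prop :=
  exists c, below (weight s) (word s - c%:S * word t).

Lemma equiv_refl s : equiv s s.
Proof. by exists 1; rewrite rmorph1 mul1r subrr; apply: below0. Qed.

Lemma equiv_trans s t u : weight s = weight t ->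
  equiv s t -> equiv t u -> equiv s u.
Proof.
move=> st [c sc] [d]; rewrite -st => td; exists (c * d).
have -> : word s - (c * d)%:S * word u =
    (word s - c%:S * word t) + c%:S * (word t - d%:S * word u).
  by rewrite mulrBr scalarA addrA subrK.
by apply: belowD => //; apply: belowZ.
Qed.

Lemma equiv_cat u s t v : equiv s t -> equiv (u ++ s ++ v) (u ++ t ++ v).
Proof.
move=> [c /(@below_cat u _ v)]; rewrite -!weight_cat -catA => h; exists c.
by move: h; rewrite mulrBr mulrBl scalarMr scalarMl !word_cat !mulrA.
Qed.

Let o0 := @Ordinal 6 0 isT.
Let o1 := @Ordinal 6 1 isT.
Let o2 := @Ordinal 6 2 isT.
Let o3 := @Ordinal 6 3 isT.
Let o4 := @Ordinal 6 4 isT.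
Let o5 := @Ordinal 6 5 isT.

Ltac is_word s := apply: (@below_eq s);
  [by rewrite /word ?big_cons big_nil ?exprS ?expr0 ?mulr1 ?mulrA | by []].

(** There is one relation for each pair of letters, and the cases follow the order of
    [g2_relations]. As [c] is nonzero, [equiv_swap] can also use the relation in the other
    direction. *)
Lemma swap_below (i j : 'I_6) : (j < i)%N ->
  exists2 c : K, c != 0 &
    below (letter_weight i + letter_weight j)
      (e i.+1 * e j.+1 - c%:S * (e j.+1 * e i.+1)).
Proof.
pose rel k := nth (0, 0) (g2_relations q e) k.
have E k : (k < 15)%N -> (rel k).1 = (rel k).2.
  by move=> ltk; apply: e_rel; rewrite mem_nth.
have subrE (u v w : A) : u = v + w -> u - v = w.
  by move=> ->; rewrite addrC addKr.
have subr_below0 (u v : A) n : u = v -> below n (u - v).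
  by move=> ->; rewrite subrr; apply: below0.
case: i j => [[|[|[|[|[|[|//]]]]]] hi] [[|[|[|[|[|[|//]]]]]] hj] // _.
all: rewrite /letter_weight /=.
- exists (q ^- 3); first by rewrite ?invr_eq0 ?expf_neq0 ?oner_neq0.
  by apply: subr_below0; apply: (E 0).
- exists q^-1; first by rewrite ?invr_eq0 ?expf_neq0 ?oner_neq0.
  rewrite (subrE _ _ _ (E 1 erefl)).
  by apply: belowN; apply: belowZ; is_word [:: o1].
- exists (q ^- 3); first by rewrite ?invr_eq0 ?expf_neq0 ?oner_neq0.
  by apply: subr_below0; apply: (E 2).
- exists 1; first by rewrite ?invr_eq0 ?expf_neq0 ?oner_neq0.
  rewrite rmorph1 mul1r; rewrite (subrE _ _ _ (E 3 erefl)).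
  by apply: belowZ; is_word [:: o2; o2].
- exists (q ^- 3); first by rewrite ?invr_eq0 ?expf_neq0 ?oner_neq0.
  rewrite (subrE _ _ _ (E 4 erefl)).
  by apply: belowN; apply: belowZ; is_word [:: o2; o2; o2].
- exists (q ^- 3); first by rewrite ?invr_eq0 ?expf_neq0 ?oner_neq0.
  by apply: subr_below0; apply: (E 5).
- exists q; first by rewrite ?invr_eq0 ?expf_neq0 ?oner_neq0.
  rewrite (subrE _ _ _ (E 6 erefl)).
  by apply: belowN; apply: belowZ; is_word [:: o2].
- exists 1; first by rewrite ?invr_eq0 ?expf_neq0 ?oner_neq0.
  rewrite rmorph1 mul1r; rewrite (subrE _ _ _ (E 7 erefl)).
  by apply: belowZ; is_word [:: o2; o2].
- exists q^-1; first by rewrite ?invr_eq0 ?expf_neq0 ?oner_neq0.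
  rewrite (subrE _ _ _ (E 8 erefl)).
  by apply: belowN; apply: belowZ; is_word [:: o3].
- exists (q ^- 3); first by rewrite ?invr_eq0 ?expf_neq0 ?oner_neq0.
  by apply: subr_below0; apply: (E 9).
- exists (q ^+ 3); first by rewrite ?invr_eq0 ?expf_neq0 ?oner_neq0.
  rewrite (subrE _ _ _ (E 10 erefl)).
  by apply: belowN; apply: belowZ; is_word [:: o4].
- exists (q ^+ 3); first by rewrite ?invr_eq0 ?expf_neq0 ?oner_neq0.
  rewrite (subrE _ _ _ (etrans (E 11 erefl) (esym (addrA _ _ _)))).
  by apply: belowD; apply: belowZ; [is_word [:: o3] | is_word [:: o2; o4]].
- exists 1; first by rewrite ?invr_eq0 ?expf_neq0 ?oner_neq0.
  rewrite rmorph1 mul1r; rewrite (subrE _ _ _ (E 12 erefl)).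
  by apply: belowZ; is_word [:: o4; o4].
- exists (q ^- 3); first by rewrite ?invr_eq0 ?expf_neq0 ?oner_neq0.
  rewrite (subrE _ _ _ (E 13 erefl)).
  by apply: belowN; apply: belowZ; is_word [:: o4; o4; o4].
- exists (q ^- 3); first by rewrite ?invr_eq0 ?expf_neq0 ?oner_neq0.
  by apply: subr_below0; apply: (E 14).
Qed.

Lemma equiv_swap i j : equiv [:: i; j] [:: j; i].
Proof.
have word2 k l : word [:: k; l] = e k.+1 * e l.+1.
  by rewrite /word big_cons big_seq1.
have weight2 k l : weight [:: k; l] = (letter_weight k + letter_weight l)%N.
  by rewrite /weight /= addn0.
case: (ltngtP i j) => [lt_ij|lt_ji|/val_inj->]; last exact: equiv_refl.
  have [c c0 cP] := swap_below lt_ij; exists c^-1.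
  rewrite !word2 weight2 addnC; set x := _ - _.
  have -> : x = - (c^-1%:S * (e j.+1 * e i.+1 - c%:S * (e i.+1 * e j.+1))).
    by rewrite mulrBr scalarA mulVf // rmorph1 mul1r opprB.
  by apply: belowN; apply: belowZ.
have [c c0 cP] := swap_below lt_ji; exists c.
by rewrite !word2 weight2.
Qed.

(** By induction on [s]: rearrange the tail first, then carry the head to its place in [t] by
    adjacent swaps. *)
Lemma equiv_perm s t : perm_eq s t -> equiv s t.
Proof.
elim: s t => [|i s IHs] t.
  by rewrite perm_sym => /perm_nilP ->; apply: equiv_refl.
move=> st; have it : i \in t by rewrite -(perm_mem st) mem_head.
case/splitPr: it st => t1 t2 st.
have {}st : perm_eq s (t1 ++ t2).
  move: st; rewrite perm_sym -cat_rcons -cats1 -catA perm_catCA /= perm_cons.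
  by rewrite perm_sym.
apply: (@equiv_trans _ (i :: t1 ++ t2)).
- by apply: weight_perm; rewrite perm_cons.
- by have := @equiv_cat [:: i] _ _ [::] (IHs _ st); rewrite !cats0.
elim: t1 {s IHs st} => [|j t1 IHt] /=; first exact: equiv_refl.
apply: (@equiv_trans _ (j :: i :: t1 ++ t2)).
- by rewrite /weight /= addnCA.
- exact: (@equiv_cat [::] _ _ (t1 ++ t2) (equiv_swap i j)).
- by have := @equiv_cat [:: j] _ _ [::] IHt; rewrite !cats0.
Qed.

(** Indices start at 0: these letters spell E_1 E_3 E_5, the leading monomial of Omega_1, and
    [even_letters] spells E_2 E_4 E_6, that of Omega_2. *)
Definition odd_letters : seq 'I_6 := [:: o0; o2; o4].
Definition even_letters : seq 'I_6 := [:: o1; o3; o5].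

(* The exponents are bounded by n; index 'I_4 numbers the letters of r. *)
Definition ordered_word n (a b : 'I_6) (k : {ffun 'I_4 -> 'I_n.+1}) :
    seq 'I_6 :=
  let r := rem b (rem a (enum 'I_6)) in
  flatten [seq nseq (k (inord (index i r))) i | i <- r].

Definition spanning_family n : seq A :=
  let letters := [seq (a, b) | a <- odd_letters, b <- even_letters] in
  [seq word (ordered_word ab.1 ab.2 k) |
    ab <- letters, k <- enum {ffun 'I_4 -> 'I_n.+1}].

Lemma size_spanning_family n : size (spanning_family n) = (9 * n.+1 ^ 4)%N.
Proof.
by rewrite !size_allpairs -cardE card_ffun !card_ord.
Qed.

Lemma perm_flatten_count (r s : seq 'I_6) : uniq r -> {subset s <= r} ->
  perm_eq s (flatten [seq nseq (count_mem i s) i | i <- r]).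
Proof.
move=> r_uniq sr; apply/allP => x _; apply/eqP.
rewrite count_flatten -map_comp sumnE big_map /=.
under eq_bigr do rewrite count_nseq /=.
have [xr|xr] := boolP (x \in r); last first.
  rewrite big_seq big1 => [|i ir].
    by apply/count_memPn; apply: contra xr => /sr.
  by case: eqP ir xr => [-> ->|].
by rewrite (bigD1_seq x) //= eqxx mul1n big1 ?addn0 // => i /negPf->.
Qed.

(** The exponents are the multiplicities of the four remaining letters. They are at most [size s],
    hence at most [weight s], since every letter has positive weight. *)
Lemma word_spanned n (s : seq 'I_6) a b :
    a \in odd_letters -> b \in even_letters -> a \notin s -> b \notin s ->
    (weight s <= n)%N ->
  exists2 t, word t \in spanning_family n & perm_eq s t.
Proof.
move=> ao be nas nbs lesn.
pose r := rem b (rem a (enum 'I_6)).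
have enumP i : i \in enum 'I_6 by rewrite mem_enum.
have ab : a != b by apply: contraTneq ao => ->; case/or4P: be => // /eqP->.
have r_uniq : uniq r by rewrite !rem_uniq // enum_uniq.
have rP i : (i \in r) = (i != b) && (i != a).
  rewrite /r mem_rem_uniq ?rem_uniq ?enum_uniq // inE.
  by rewrite mem_rem_uniq ?enum_uniq // inE /= enumP andbT.
have r_size : size r = 4%N.
  rewrite !size_rem ?size_enum_ord // mem_rem_uniq ?enum_uniq //.
  by rewrite inE enumP andbT eq_sym.
pose k : {ffun 'I_4 -> 'I_n.+1} :=
  [ffun j : 'I_4 => inord (count_mem (nth a r j) s)].
exists (ordered_word a b k).
  apply/allpairsP; exists ((a, b), k); split => //; last by rewrite mem_enum.
  exact: allpairs_f.
have sr : {subset s <= r}.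
  move=> i si; rewrite rP; apply/andP.
  by split; [apply: contraNneq nbs | apply: contraNneq nas] => <-.
rewrite /ordered_word -/r.
rewrite (_ : [seq _ | i <- r] = [seq nseq (count_mem i s) i | i <- r]).
  exact: perm_flatten_count.
apply/eq_in_map => i ir; congr nseq.
have lt4 : (index i r < 4)%N by move: ir; rewrite -index_mem r_size.
rewrite ffunE (inordK lt4) nth_index // inordK //.
rewrite ltnS; apply: leq_trans lesn; apply: leq_trans (size_le_weight s).
exact: count_size.
Qed.

(** E_1 E_3 E_5 has weight 8; the other terms of Omega_1 have weights 7, 6 and 4, and alpha has
    weight 0. *)
Lemma odd_letters_below : below (weight odd_letters) (word odd_letters).
Proof.
have wordE : word odd_letters = e 1 * e 3 * e 5.
  by rewrite /word !big_cons big_nil mulr1 mulrA.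
have := e_Omega1; rewrite /g2_Omega1 -wordE -!addrA => /(canRL (addrK _)) ->.
rewrite -[alpha%:S]mulr1 ?scalarMl; apply: belowB.
  by apply: belowZ; is_word (Nil 'I_6).
repeat apply: belowD; apply: belowZ.
- is_word [:: o0; o3].
- is_word [:: o1; o4].
- is_word [:: o2; o2].
Qed.

(** E_2 E_4 E_6 has weight 11; the other terms of Omega_2 have weights 10, 10, 8, 7 and 6, and beta
    has weight 0. *)
Lemma even_letters_below : below (weight even_letters) (word even_letters).
Proof.
have wordE : word even_letters = e 2 * e 4 * e 6.
  by rewrite /word !big_cons big_nil mulr1 mulrA.
have := e_Omega2; rewrite /g2_Omega2 -wordE -!addrA => /(canRL (addrK _)) ->.
rewrite -[beta%:S]mulr1 ?scalarMl; apply: belowB.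
  by apply: belowZ; is_word (Nil 'I_6).
repeat apply: belowD; apply: belowZ.
- is_word [:: o1; o4; o4; o4].
- is_word [:: o2; o2; o2; o5].
- is_word [:: o2; o2; o4; o4].
- is_word [:: o2; o3; o4].
- is_word [:: o3; o3].
Qed.

Lemma perm_cat_uniq (u s : seq 'I_6) : uniq u -> all (mem s) u ->
  exists t, perm_eq s (u ++ t).
Proof.
elim: u s => [|i u IHu] s /=; first by exists s.
move=> /andP[niu u_uniq] /andP[/= si us].
have [|t st] := IHu (rem i s) u_uniq.
  apply/allP => j ju; have /= := allP us j ju.
  rewrite (perm_mem (perm_to_rem si)) inE => /predU1P[ji|//].
  by move: niu; rewrite -ji ju.
by exists t; rewrite /= (permPl (perm_to_rem si)) perm_cons.
Qed.

(** Strong induction on the weight. If all odd letters or all even letters occur, they are moved to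
    the front and replaced by lower terms; otherwise a letter of each kind is missing and
    [word_spanned] applies. *)
Lemma word_in_span n s : (weight s <= n)%N ->
  lin_span [set` spanning_family n] (word s).
Proof.
have [_ spanD spanZ] := lin_span_subspace [set` spanning_family n].
move: {2}(weight s) (leqnn (weight s)) => N.
elim/ltn_ind: N s => N IHN s leN len.
have span_below x : below (weight s) x -> lin_span [set` spanning_family n] x.
  apply: lin_span_min; first exact: lin_span_subspace.
  move=> _ [t ltts <-]; apply: (IHN (weight t)) => //.
    exact: leq_trans ltts leN.
  exact: leq_trans (ltnW ltts) len.
have reduce t : perm_eq s t -> lin_span [set` spanning_family n] (word t) ->
    lin_span [set` spanning_family n] (word s).
  move=> /equiv_perm[c sct] st; rewrite -(subrK (c%:S * word t) (word s)).
  by apply: spanD; [exact: span_below | exact: spanZ].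
have leading u : uniq u -> below (weight u) (word u) -> all (mem s) u ->
    lin_span [set` spanning_family n] (word s).
  move=> u_uniq u_below /(perm_cat_uniq u_uniq)[t st]; apply: reduce (st) _.
  apply: span_below; rewrite (weight_perm st) weight_cat word_cat.
  have := @below_cat [::] _ t _ u_below.
  by rewrite /word big_nil mul1r.
have [odd_s|/allPn[a ao nas]] := boolP (all (mem s) odd_letters).
  exact (leading odd_letters isT odd_letters_below odd_s).
have [even_s|/allPn[b be nbs]] := boolP (all (mem s) even_letters).
  exact (leading even_letters isT even_letters_below even_s).
have [t tn st] := word_spanned ao be nas nbs len.
by apply: reduce st _; apply: sub_lin_span.
Qed.

Lemma below_span n : below n.+1 `<=` lin_span [set` spanning_family n].
Proof.
apply: lin_span_min; first exact: lin_span_subspace.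
by move=> _ [s ltsn <-]; apply: word_in_span.
Qed.

Lemma below_mono m n : (m <= n)%N -> below m `<=` below n.
Proof.
move=> lemn; apply: lin_span_min; first exact: lin_span_subspace.
by move=> _ [s ltsm <-]; apply: below_word; apply: leq_trans lemn.
Qed.

Lemma belowM m n x y :
  below m.+1 x -> below n.+1 y -> below (m + n).+1 (x * y).
Proof.
move=> mx; move: y; apply: lin_span_min => [|_ [t lttn <-]].
  split=> [|y z|c y]; rewrite /= ?mulr0 ?mulrDr ?scalarMr.
  - exact: below0.
  - exact: belowD.
  - exact: belowZ.
have := @below_cat [::] _ t _ mx; rewrite {1}/word big_nil mul1r /=.
by apply: below_mono; rewrite addSn ltnS leq_add2l -ltnS.
Qed.

(** The filtration is exhaustive, that is, the letters generate [A]. *)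
Hypothesis e_gen : forall x, exists n, below n x.

Lemma fin_dim_below (V : set A) : fin_dim_subspace V ->
  exists n, V `<=` below n.+1.
Proof.
move=> [X ->]; suff [n nX] : exists n, forall x, x \in X -> below n.+1 x.
  by exists n; apply: lin_span_min => //; apply: lin_span_subspace.
elim: X => [|x X [n nX]]; first by exists 0%N.
have [m mx] := e_gen x; exists (m + n)%N => y; rewrite inE => /predU1P[->|/nX].
  by apply: below_mono mx; rewrite leqW // leq_addr.
by apply: below_mono; rewrite ltnS leq_addl.
Qed.

Lemma subspace_pow_below (V : set A) m n : V `<=` below m.+1 ->
  subspace_pow V n `<=` below (m * n).+1.
Proof.
move=> Vm; elim: n => [|n IHn] /=; apply: lin_span_min;
  try exact: lin_span_subspace.
  by move=> _ ->; apply: (@below_eq [::]); rewrite ?muln0 // /word big_nil.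
move=> _ [x /IHn nx [y /Vm my <-]]; rewrite mulnS addnC; exact: belowM.
Qed.

Definition growth_space (V : set A) (n : nat) : set A :=
  lin_span (\bigcup_(i in [set i | (i <= n)%N]) subspace_pow V i).

Lemma growth_space_spanned (V : set A) : fin_dim_subspace V ->
  exists m, forall n,
    growth_space V n `<=` lin_span [set` spanning_family (m * n)].
Proof.
move=> /fin_dim_below[m Vm]; exists m => n.
apply: subset_trans (@below_span (m * n)).
apply: lin_span_min; first exact: lin_span_subspace.
move=> x [i /= lein]; move/(subspace_pow_below Vm); apply: below_mono.
by rewrite ltnS leq_mul2l lein orbT.
Qed.

Lemma growth_le (V : set A) : fin_dim_subspace V ->
  exists m, forall n, (growth V n <= 9 * (m * n).+1 ^ 4)%N.
Proof.
move=> /growth_space_spanned[m Vm]; exists m => n.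
by rewrite -size_spanning_family; apply: subspace_dim_le; apply: Vm.
Qed.

(** The spanning families of the upper bound show that the growth space is finite-dimensional, as
    [subspace_dim_ge] requires. *)
Lemma growth_ge (V : set A) (Y : seq A) n : fin_dim_subspace V ->
  lin_indep Y -> [set` Y] `<=` growth_space V n -> (size Y <= growth V n)%N.
Proof.
move=> /growth_space_spanned[m Vm]; apply: subspace_dim_ge (Vm n).
exact: lin_span_subspace.
Qed.

End Straightening.

(** * Generation of the quotient algebra by E_1, ..., E_6 *)

Section Generation.
Local Open Scope classical_set_scope.
Variables (K : fieldType) (q alpha beta : K).
Local Notation A := (A_alg q alpha beta).
Local Notation e := (@A_gen K q alpha beta).

Lemma A_gen_below x : exists n, below e n x.
Proof.
have [y ->] := quotient_proj_surj x; have [z ->] := quotient_proj_surj y.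
have projM (B : pzAlgType K) (S : set B) :
    {morph quotient_proj S : u v / u * v}.
  exact: rmorphM.
have projU k : quotient_proj _ (quotient_proj _ << k : {fmonom 'I_6} >>)
    = word e k :> A.
  case: k => s; elim: s => [|i s IHs].
    rewrite -fmoneE -[<< _ >>]/(1 : {malg K[{fmonom 'I_6}]}) !rmorph1.
    by rewrite fmoneE /word big_nil.
  have -> : << FMonom (i :: s) >> = free_gen K i.+1 * << FMonom s >>.
    rewrite malgM_def fgmulUU mulr1 /free_gen /= inord_val.
    by congr << _ >>; apply/eqP; rewrite fmP /= fmM fmU.
  by rewrite !projM IHs /= word_cons.
rewrite [z]monalgE; elim/big_ind: _ => [|z1 z2 [n1 h1] [n2 h2]|k _].
- by exists 0%N; rewrite !rmorph0; apply: below0.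
- exists (maxn n1 n2); rewrite !rmorphD; apply: belowD.
    by apply: below_mono h1; apply: leq_maxl.
  by apply: below_mono h2; apply: leq_maxr.
exists (weight k).+1.
have -> : << z@_k *g k >> = (z@_k)%:S * << k >> :> {malg K[{fmonom 'I_6}]}.
  by rewrite malgM_def fgmulUU mulr1 mul1m.
rewrite !projM; apply: belowZ; apply: below_eq (esym (projU k)) _.
exact: ltnSn.
Qed.

End Generation.

(** * Lower bound: a quantum torus of rank 4 *)

Definition lattice := (int * int * int * int)%type.

(** * The algebra of linear operators on functions on Z^4 *)

Section Operators.
Variable K : fieldType.
Local Notation V := (lattice -> K).

(** Linearity is bundled because it gives x (y + z) = x y + x z and makes the scalars central;
    associativity is that of composition. *)
Record op := Op {
  op_fun :> V -> V;
  op_linear : forall c f g,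
    op_fun (fun w => c * f w + g w) = fun w => c * op_fun f w + op_fun g w
}.
Implicit Types x y z : op.

HB.instance Definition _ := gen_eqMixin op.
HB.instance Definition _ := gen_choiceMixin op.

Lemma op_ext x y : (forall f w, x f w = y f w) -> x = y.
Proof.
move=> xy; have {xy} : op_fun x = op_fun y by apply/funext=> f; apply/funext.
by case: x y => [x xP] [y yP] /= xy; subst y; congr Op; apply: Prop_irrelevance.
Qed.

Lemma opD x f g : x (fun w => f w + g w) = fun w => x f w + x g w.
Proof.
under [X in op_fun x X]eq_fun do rewrite -[f _]mul1r.
by rewrite op_linear; under eq_fun do rewrite mul1r.
Qed.

Lemma op0f x : x (fun=> 0) = fun=> 0.
Proof.
apply/funext => w; have /(congr1 (@^~ w)) := opD x (fun=> 0) (fun=> 0).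
under [X in op_fun x X]eq_fun do rewrite addr0.
by move=> /esym/eqP; rewrite -subr_eq0 addrK => /eqP.
Qed.

Lemma opZ x c f : x (fun w => c * f w) = fun w => c * x f w.
Proof.
under [X in op_fun x X]eq_fun do rewrite -[_ * _]addr0.
by rewrite op_linear op0f; under eq_fun do rewrite addr0.
Qed.

Definition op_zero : op.
Proof.
by exists (fun _ _ => 0) => c f g; apply/funext => w; rewrite mulr0 addr0.
Defined.

Definition op_opp x : op.
Proof.
exists (fun f w => - x f w) => c f g; apply/funext => w.
by rewrite op_linear opprD mulrN.
Defined.
Definition op_add x y : op.
Proof.
exists (fun f w => x f w + y f w) => c f g; apply/funext => w.
by rewrite !op_linear mulrDr addrACA.
Defined.
Definition op_one : op. Proof. by exists id. Defined.
Definition op_mul x y : op.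
Proof. by exists (fun f => x (y f)) => c f g; rewrite !op_linear. Defined.

Let opaddA : associative op_add.
Proof. by move=> x y z; apply: op_ext => f w /=; rewrite addrA. Qed.
Let opaddC : commutative op_add.
Proof. by move=> x y; apply: op_ext => f w /=; rewrite addrC. Qed.
Let opadd0 : left_id op_zero op_add.
Proof. by move=> x; apply: op_ext => f w /=; rewrite add0r. Qed.
Let opaddN : left_inverse op_zero op_opp op_add.
Proof. by move=> x; apply: op_ext => f w /=; rewrite addNr. Qed.
HB.instance Definition _ :=
  GRing.isZmodule.Build op opaddA opaddC opadd0 opaddN.

Let opmulA : associative op_mul.
Proof. by move=> x y z; apply: op_ext. Qed.
Let opmul1 : left_id op_one op_mul.
Proof. by move=> x; apply: op_ext. Qed.
Let op1mul : right_id op_one op_mul.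
Proof. by move=> x; apply: op_ext. Qed.
Let opmulDl : left_distributive op_mul op_add.
Proof. by move=> x y z; apply: op_ext. Qed.
Let opmulDr : right_distributive op_mul op_add.
Proof. by move=> x y z; apply: op_ext => f w; rewrite /= opD. Qed.
Let op1_neq0 : op_one != op_zero.
Proof.
apply/eqP => /(congr1 (fun x : op => x (fun=> 1) 0))/eqP.
by rewrite /= oner_eq0.
Qed.
HB.instance Definition _ := GRing.Zmodule_isNzRing.Build op
  opmulA opmul1 op1mul opmulDl opmulDr op1_neq0.

Lemma op_addE x y f w : (x + y) f w = x f w + y f w. Proof. by []. Qed.
Lemma op_mulE x y f : (x * y) f = x (y f). Proof. by []. Qed.

Definition op_scalar (c : K) : op.
Proof.
exists (fun f w => c * f w) => d f g; apply/funext => w.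
by rewrite mulrDr mulrCA.
Defined.

Let op_scalarB : zmod_morphism op_scalar.
Proof. by move=> c d; apply: op_ext => f w; rewrite /= mulrBl. Qed.
Let op_scalarM : monoid_morphism op_scalar.
Proof.
by split=> [|c d]; apply: op_ext => f w; rewrite /= ?mul1r // mulrA.
Qed.
HB.instance Definition _ :=
  GRing.isZmodMorphism.Build K op op_scalar op_scalarB.
HB.instance Definition _ :=
  GRing.isMonoidMorphism.Build K op op_scalar op_scalarM.

Lemma op_scalarC c x : op_scalar c * x = x * op_scalar c.
Proof. by apply: op_ext => f w; rewrite !op_mulE /= opZ. Qed.

HB.instance Definition _ := PzRing_isPzAlgebra.Build K op op_scalarC.

End Operators.

(* x^u x^v = q^(cocycle u v) x^(u + v) for the ordered monomials x^u in
   x_1 = E_1, x_2 = E_2, x_3 = u_3, x_4 = u_4. *)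
Definition cocycle (u v : lattice) : int :=
  let: (u1, u2, u3, u4) := u in let: (v1, v2, v3, v4) := v in
  - ((3 * u2 + u3 + 3 * u4) * v1 + 3 * u4 * (v2 + v3)).

Arguments cocycle : simpl never.

(** Being bilinear, [cocycle] is a 2-cocycle; this makes the twisted shifts compose as in
    [qmonomM]. *)
Lemma cocycleDl u u' v : cocycle (u + u') v = cocycle u v + cocycle u' v.
Proof.
case: u u' v => [[[u1 u2] u3] u4] [[[u1' u2'] u3'] u4'] [[[v1 v2] v3] v4].
by rewrite /cocycle; ring.
Qed.

Lemma cocycleDr u v v' : cocycle u (v + v') = cocycle u v + cocycle u v'.
Proof.
case: u v v' => [[[u1 u2] u3] u4] [[[v1 v2] v3] v4] [[[v1' v2'] v3'] v4'].
by rewrite /cocycle; ring.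
Qed.

(* The key ((k, (i, j)), v) stands for q^k a^i b^j x^v, where a and b are the
   rescaled values of Omega_1 and Omega_2. *)
Definition qkey := (int * (nat * nat) * lattice)%type.
Definition qkey_mul (s t : qkey) : qkey :=
  (s.1.1 + t.1.1 + cocycle s.2 t.2,
   (s.1.2.1 + t.1.2.1, s.1.2.2 + t.1.2.2)%N, s.2 + t.2).
Definition qlaurent := seq (int * qkey).

Fixpoint qinsert (t : int * qkey) (p : qlaurent) : qlaurent :=
  if p is s :: p' then
    if s.2 == t.2 then (s.1 + t.1, s.2) :: p' else s :: qinsert t p'
  else [:: t].
(** Like terms are merged and zero coefficients dropped, so that an identity can be tested by
    computing whether a difference is the empty list. *)
Definition qnorm (p : qlaurent) : qlaurent :=
  [seq t <- foldr qinsert [::] p | t.1 != 0].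
Definition qmul (p r : qlaurent) : qlaurent :=
  qnorm [seq (s.1 * t.1, qkey_mul s.2 t.2) | s <- p, t <- r].
Definition qadd (p r : qlaurent) : qlaurent := qnorm (p ++ r).
Definition qopp (p : qlaurent) : qlaurent := [seq (- t.1, t.2) | t <- p].
Definition qgen (k : qkey) : qlaurent := [:: (1, k)].
Definition qpow (k : int) : qlaurent := qgen (k, (0, 0)%N, 0).

Declare Scope q_scope.
Delimit Scope q_scope with q.
Infix "+" := qadd : q_scope.
Infix "*" := qmul : q_scope.
Notation "- x" := (qopp x) : q_scope.
Notation "x - y" := (qadd x (qopp y)) : q_scope.

(** * Evaluation of symbolic Laurent polynomials as operators *)

Section Eval.
Variables (K : fieldType) (q : K).
Hypothesis q_neq0 : q != 0.

(** Read [f] as the linear functional on the torus with value [f w] at x^w. The operator of c x^v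
    then sends it to y -> f (y c x^v), the dual of right multiplication, which is a left action. *)
Definition qmonom (c : K) (v : lattice) : op K.
Proof.
exists (fun f w => c * q ^ cocycle w v * f (w + v)) => d f g.
by apply/funext => w; rewrite mulrDr mulrCA.
Defined.

Lemma qmonomM c d u v :
  qmonom c u * qmonom d v = qmonom (c * d * q ^ cocycle u v) (u + v).
Proof.
apply: op_ext => f w; rewrite op_mulE /= addrA cocycleDl cocycleDr !expfzDr //.
by ring.
Qed.

Lemma qmonomD c d v : qmonom (c + d) v = qmonom c v + qmonom d v.
Proof. by apply: op_ext => f w; rewrite op_addE /= !mulrDl. Qed.

Lemma qmonom0 v : qmonom 0 v = 0.
Proof. by apply: op_ext => f w; rewrite /= !mul0r. Qed.

Lemma cocycle0r u : cocycle u 0 = 0.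
Proof. by case: u => [[[u1 u2] u3] u4]; rewrite /cocycle /=; ring. Qed.

Lemma qmonom_scalar c : qmonom c 0 = c%:S.
Proof. by apply: op_ext => f w; rewrite /= cocycle0r mulr1 addr0. Qed.

Variables a b : K.

Definition keycoef (k : qkey) : K := q ^ k.1.1 * a ^+ k.1.2.1 * b ^+ k.1.2.2.
Definition qeval1 (t : int * qkey) : op K :=
  qmonom (t.1%:~R * keycoef t.2) t.2.2.
Definition qeval (p : qlaurent) : op K := \sum_(t <- p) qeval1 t.

Lemma qeval_cat p r : qeval (p ++ r) = qeval p + qeval r.
Proof. by rewrite /qeval big_cat. Qed.

Lemma qeval_insert t p : qeval (qinsert t p) = qeval1 t + qeval p.
Proof.
elim: p => [|s p IHp] /=; first by rewrite /qeval big_seq1 big_nil addr0.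
case: eqP => [eq_st|_]; rewrite /qeval !big_cons.
  rewrite addrA; congr (_ + _).
  by rewrite /qeval1 /= -eq_st rmorphD mulrDl qmonomD addrC.
by rewrite -!/(qeval _) IHp addrCA.
Qed.

Lemma qeval_norm p : qeval (qnorm p) = qeval p.
Proof.
rewrite /qnorm; transitivity (qeval (foldr qinsert [::] p)).
  rewrite /qeval big_filter big_mkcond; apply: eq_bigr => t _ /=.
  by case: eqP => // t0; rewrite /qeval1 t0 mul0r qmonom0.
elim: p => //= t p IHp.
by rewrite qeval_insert IHp /qeval big_cons.
Qed.

Lemma qevalD p r : qeval (p + r)%q = qeval p + qeval r.
Proof. by rewrite qeval_norm qeval_cat. Qed.

Lemma qevalN p : qeval (- p)%q = - qeval p.
Proof.
rewrite /qeval big_map -sumrN; apply: eq_bigr => t _; apply/eqP.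
by rewrite -addr_eq0 -qmonomD -mulrDl -rmorphD addNr mul0r qmonom0.
Qed.

Lemma qevalM p r : qeval (p * r)%q = qeval p * qeval r.
Proof.
rewrite qeval_norm /qeval big_allpairs_dep mulr_suml; apply: eq_bigr => s _.
rewrite mulr_sumr; apply: eq_bigr => t _; rewrite /qeval1 qmonomM /keycoef /=.
by congr qmonom; rewrite rmorphM !expfzDr // !exprD; ring.
Qed.

Lemma qeval_gen k : qeval (qgen k) = qmonom (keycoef k) k.2.
Proof. by rewrite /qeval big_seq1 /qeval1 mul1r. Qed.

Lemma qeval_pow k : qeval (qpow k) = (q ^ k)%:S.
Proof. by rewrite qeval_gen /keycoef !mulr1 qmonom_scalar. Qed.

Lemma qeval_eq p r : (p - r)%q = [::] -> qeval p = qeval r.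
Proof.
move=> pr; apply/eqP; rewrite -subr_eq0 -qevalN -qevalD pr.
by rewrite /qeval big_nil.
Qed.

End Eval.

(** * Rescaled generators with integral relations *)

Section Rescaling.
Variables (K : fieldType) (q : K).
Hypothesis q_neq0 : q != 0.
Hypothesis q_not_root_of_unity : forall n : nat, (0 < n)%N -> q ^+ n != 1.
Let m := q ^+ 2 - 1.
Let d := q ^+ 4 + q ^+ 2 + 1.
Variables (A : pzAlgType K) (h : nat -> A).

(* The relations between suitably rescaled generators: their coefficients are
   Laurent polynomials in q. *)
Definition integral_relations : seq (A * A) :=
  let md := m%:S * d%:S in
  [:: (h 2 * h 1, (q ^ (-3))%:S * (h 1 * h 2));
      (h 3 * h 1, (q ^ (-1))%:S * (h 1 * h 3) - (q ^ (-3))%:S * m%:S * h 2);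
      (h 3 * h 2, (q ^ (-3))%:S * (h 2 * h 3));
      (h 4 * h 1, h 1 * h 4 - md * h 3 ^+ 2);
      (h 4 * h 2, (q ^ (-3))%:S * (h 2 * h 4) - md * h 3 ^+ 3);
      (h 4 * h 3, (q ^ (-3))%:S * (h 3 * h 4));
      (h 5 * h 1, (q ^ 1)%:S * (h 1 * h 5)
                  - m%:S * h 3 - (q ^ 2)%:S * m%:S * h 3);
      (h 5 * h 2, h 2 * h 5 - md * h 3 ^+ 2);
      (h 5 * h 3, (q ^ (-1))%:S * (h 3 * h 5) - (q ^ (-3))%:S * m%:S * h 4);
      (h 5 * h 4, (q ^ (-3))%:S * (h 4 * h 5));
      (h 6 * h 1, (q ^ 3)%:S * (h 1 * h 6) - (q ^ 3)%:S * md * h 5);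
      (h 6 * h 2, (q ^ 3)%:S * (h 2 * h 6) + (q ^ 4)%:S * md * h 4
                  + (q ^ 2)%:S * md * h 4 - md * h 4
                  - (q ^ 2)%:S * d%:S * md * (h 3 * h 5));
      (h 6 * h 3, h 3 * h 6 - md * h 5 ^+ 2);
      (h 6 * h 4, (q ^ (-3))%:S * (h 4 * h 6) - md * h 5 ^+ 3);
      (h 6 * h 5, (q ^ (-3))%:S * (h 5 * h 6))].

Definition integral_Omega1 : A :=
  h 1 * h 3 * h 5 - h 1 * h 4 - h 2 * h 5 + (q ^ 6)%:S * h 3 ^+ 2.
Definition integral_Omega2 : A :=
  h 2 * h 4 * h 6 - (q ^ 9)%:S * (h 2 * h 5 ^+ 3)
  - (q ^ 9)%:S * (h 3 ^+ 3 * h 6)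
  + (q ^ 11)%:S * d%:S * (h 3 ^+ 2 * h 5 ^+ 2)
  - (q ^ 9)%:S * d%:S * (h 3 * h 4 * h 5) + (q ^ 12)%:S * h 4 ^+ 2.

Lemma q2B1_neq0 : q ^+ 2 - 1 != 0.
Proof. by rewrite subr_eq0 q_not_root_of_unity. Qed.

Lemma q6B1_neq0 : q ^+ 6 - 1 != 0.
Proof. by rewrite subr_eq0 q_not_root_of_unity. Qed.

(** It divides q^6 - 1, which is nonzero. *)
Lemma q4Dq2D1_neq0 : q ^+ 4 + q ^+ 2 + 1 != 0.
Proof.
apply: contra_neq q6B1_neq0 => d0.
by transitivity ((q ^+ 4 + q ^+ 2 + 1) * (q ^+ 2 - 1)); [ring|rewrite d0 mul0r].
Qed.

(** These scalars clear the denominators of the relations and give all terms of each Omega a common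
    factor. The leading 0 pads the list, as generators are numbered from 1. *)
Definition rescaled (k : nat) : A :=
  (nth 0 [:: 0; 1; d^-1; m^-1; m^-1 ^+ 2 / d; m^-1 ^+ 2; m^-1 ^+ 3 / d] k)%:S
  * h k.

Ltac field_tac := rewrite /m /d; field;
  rewrite ?q_neq0 ?q2B1_neq0 ?q4Dq2D1_neq0 ?q6B1_neq0.

Let zq : (q ^ (-3) = q ^- 3) * (q ^ (-1) = q^-1) * (q ^ 1 = q) *
  (q ^ 2 = q ^+ 2) * (q ^ 3 = q ^+ 3) * (q ^ 4 = q ^+ 4) * (q ^ 6 = q ^+ 6) *
  (q ^ 9 = q ^+ 9) * (q ^ 11 = q ^+ 11) * (q ^ 12 = q ^+ 12).
Proof. by []. Qed.

Lemma rescaled_relations :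
  (forall r, r \in integral_relations -> r.1 = r.2) ->
  forall r, r \in g2_relations q rescaled -> r.1 = r.2.
Proof.
move=> H r; rewrite !inE.
have {}H i : (i < 15)%N -> (nth (0, 0) integral_relations i).1 =
   (nth (0, 0) integral_relations i).2.
  by move=> lti; apply: H; rewrite mem_nth.
repeat move=> /orP[]; move=> /eqP-> /=.
all: rewrite ?scalarX ?scalarMM ?scalarA.
all: [> have /= -> := H 0%N erefl | have /= -> := H 1%N erefl
  | have /= -> := H 2%N erefl | have /= -> := H 3%N erefl
  | have /= -> := H 4%N erefl | have /= -> := H 5%N erefl
  | have /= -> := H 6%N erefl | have /= -> := H 7%N erefl
  | have /= -> := H 8%N erefl | have /= -> := H 9%N erefl
  | have /= -> := H 10%N erefl | have /= -> := H 11%N erefl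
  | have /= -> := H 12%N erefl | have /= -> := H 13%N erefl
  | have /= -> := H 14%N erefl].
all: rewrite -?(rmorphM pzscalar) /= ?zq ?scalarN ?mulrDr ?scalarA.
all: try by congr (_%:S * _); field_tac.
all: try by congr (_%:S * _ + _%:S * _); field_tac.
(* For E_5 E_1 and, next, E_6 E_2: [integral_relations] splits the coefficients 1 + q^2 and q^4 +
   q^2 - 1 into single powers of q, which are recombined here. *)
- rewrite -addrA -mulrDl -rmorphD.
  by congr (_%:S * _ + _%:S * _); field_tac.
- do 2 rewrite -(addrA _ (_ * h 4) (_ * h 4)) -mulrDl -rmorphD.
  by congr (_%:S * _ + _%:S * _ + _%:S * _); field_tac.
Qed.

Let onem_neq0 (n : nat) : (0 < n)%N -> 1 + -1 * q ^+ n != 0.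
Proof.
move=> n0; rewrite mulN1r subr_eq0 eq_sym; exact: q_not_root_of_unity.
Qed.

Lemma rescaled_Omega1 :
  g2_Omega1 q rescaled = (m ^- 3)%:S * integral_Omega1.
Proof.
rewrite /g2_Omega1 /integral_Omega1 /rescaled /=.
rewrite ?(scalarX, scalarA, scalarMl, scalarMr).
rewrite ?zq ?mulrDr ?mulrN ?scalarA ?scalarN.
by congr (_%:S * _ + _%:S * _ + _%:S * _ + _%:S * _); field_tac;
  rewrite ?onem_neq0.
Qed.

Lemma rescaled_Omega2 :
  g2_Omega2 q rescaled = (m ^- 5 / d ^+ 3)%:S * integral_Omega2.
Proof.
rewrite /g2_Omega2 /integral_Omega2 /rescaled /= -/d.
(* The numerator is q^3 m^2, and 1 - q^-6 = q^-6 m d. *)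
have -> : - ((q ^+ 7 - 2 * q ^+ 5 + q ^+ 3) / (d * (1 - q ^- 6))) =
    - q ^+ 9 * m / d ^+ 2.
  by field_tac; rewrite ?onem_neq0.
have -> : (q ^+ 13 - q ^+ 11) / d ^+ 2 = q ^+ 11 * m / d ^+ 2.
  by congr (_ / _); rewrite /m; ring.
have -> : q ^+ 12 / (q ^+ 6 - 1) = q ^+ 12 / (m * d).
  by congr (_ / _); rewrite /m /d; ring.
have := q2B1_neq0; have := q4Dq2D1_neq0; rewrite -/m -/d.
(* What remains are identities in which q, m and d may be treated as independent. *)
move: m d => m' d' d0 m0.
rewrite ?(scalarX, scalarA, scalarMl, scalarMr).
rewrite ?zq -?(rmorphM pzscalar) /= ?mulrDr ?mulrN ?scalarA ?scalarN.
by congr (_%:S * _ + _%:S * _ + _%:S * _ + _%:S * _ + _%:S * _ + _%:S * _);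
  field; rewrite ?m0 ?d0.
Qed.

End Rescaling.

Definition qx (v : lattice) : qlaurent := qgen (0, (0, 0)%N, v).
Definition qa : qlaurent := qgen (0, (1, 0)%N, 0).
Definition qb : qlaurent := qgen (0, (0, 1)%N, 0).
Definition qd : qlaurent := (qpow 4 + qpow 2 + qpow 0)%q.
Definition qm : qlaurent := (qpow 2 - qpow 0)%q.

(* E_1, ..., E_6 up to the scalars in rescaled. *)
Definition qE1 : qlaurent := qx (1, 0, 0, 0).
Definition qE2 : qlaurent := qx (0, 1, 0, 0).
Definition qE3 : qlaurent := (qx (-1, 0, 0, 0) * (qx (0, 0, 1%R, 0) + qE2))%q.
Definition qE4 : qlaurent :=
  (qx (0, -1, 0, 0)%R * (qx (0, 0, 0, 1%R) + qpow 9 * (qE3 * qE3 * qE3)))%q.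
(** In the rescaled Omega_1 the terms ending in E_5 add up to (E_1 E_3 - E_2) E_5 = x_3 E_5, so
    solving for E_5 only inverts x_3. *)
Definition qE5 : qlaurent :=
  (qx (0, 0, -1, 0)%R * (qa + qE1 * qE4 - qpow 6 * (qE3 * qE3)))%q.
(** Likewise the terms of Omega_2 ending in E_6 add up to (E_2 E_4 - q^9 E_3^3) E_6 = x_4 E_6. *)
Definition qE6 : qlaurent :=
  (qx (0, 0, 0, -1)%R *
   (qb + qpow 9 * (qE2 * (qE5 * qE5 * qE5))
    - qpow 11 * qd * (qE3 * qE3 * (qE5 * qE5))
    + qpow 9 * qd * (qE3 * qE4 * qE5) - qpow 12 * (qE4 * qE4)))%q.

Definition qE (k : nat) : qlaurent :=
  nth [::] [:: [::]; qE1; qE2; qE3; qE4; qE5; qE6] k.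

(** * The relations in the quantum torus *)

Section TorusRepresentation.
Variables (K : fieldType) (q : K).
Hypothesis q_neq0 : q != 0.
Hypothesis q_not_root_of_unity : forall n : nat, (0 < n)%N -> q ^+ n != 1.
Variables alpha beta : K.

Let d := q ^+ 4 + q ^+ 2 + 1.
Let m := q ^+ 2 - 1.
(** The factors in [a] and [b] cancel those of [rescaled_Omega1] and [rescaled_Omega2]. *)
Let a := alpha * m ^+ 3.
Let b := beta * m ^+ 5 * d ^+ 3.

Local Notation ev := (qeval q a b).

Definition integral_gen (k : nat) : op K := ev (qE k).
Definition torus_gen : nat -> op K := rescaled q integral_gen.

Let ev_d : ev qd = d%:S.
Proof. by rewrite !qevalD // !qeval_pow // -!rmorphD. Qed.

Let ev_m : ev qm = m%:S.
Proof. by rewrite qevalD // qevalN !qeval_pow // -rmorphB. Qed.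

Let ev_add p r x y : ev p = x -> ev r = y -> ev (p + r)%q = x + y.
Proof. by move=> <- <-; apply: qevalD. Qed.

Let ev_opp p x : ev p = x -> ev (- p)%q = - x.
Proof. by move=> <-; apply: qevalN. Qed.

Let ev_mul p r x y : ev p = x -> ev r = y -> ev (p * r)%q = x * y.
Proof. by move=> <- <-; apply: qevalM. Qed.

Let ev_eq p r x y : ev p = x -> ev r = y -> (p - r)%q = [::] -> x = y.
Proof. by move=> <- <-; apply: qeval_eq. Qed.

Ltac reify := lazymatch goal with
  | |- _ = _ + _ => apply: ev_add; reify
  | |- _ = - _ => apply: ev_opp; reify
  | |- _ = _ * _ => apply: ev_mul; reify
  | |- _ = ev _ => reflexivity
  | |- _ => first [exact: ev_m | exact: ev_d | exact: qeval_pow]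
  end.

(** Proof by reflection: both sides are read as symbolic Laurent polynomials and their difference is
    normalised. Since q, a and b stay symbolic, one computation covers all values. *)
Ltac torus_eq :=
  rewrite ?expr2 ?[_ ^+ 3]exprSr ?expr2;
  apply: ev_eq; [reify | reify | vm_compute; reflexivity].

Lemma integral_relations_torus r :
  r \in integral_relations q integral_gen -> r.1 = r.2.
Proof.
rewrite !inE; repeat move=> /orP[]; move=> /eqP->; cbn [fst snd].
all: rewrite /integral_gen; torus_eq.
Qed.

Lemma integral_Omega1_torus : integral_Omega1 q integral_gen = a%:S.
Proof.
transitivity (ev qa); last first.
  by rewrite qeval_gen qmonom_scalar /keycoef mul1r mulr1.
rewrite /integral_Omega1 /integral_gen; torus_eq.
Qed.

Lemma integral_Omega2_torus : integral_Omega2 q integral_gen = b%:S.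
Proof.
transitivity (ev qb); last first.
  by rewrite qeval_gen qmonom_scalar /keycoef !mul1r.
rewrite /integral_Omega2 /integral_gen; torus_eq.
Qed.

Lemma g2_relations_torus r : r \in g2_relations q torus_gen -> r.1 = r.2.
Proof. exact/rescaled_relations/integral_relations_torus. Qed.

Lemma g2_Omega1_torus : g2_Omega1 q torus_gen = alpha%:S.
Proof.
rewrite rescaled_Omega1 // integral_Omega1_torus -rmorphM /a mulrC mulfK //.
by rewrite expf_neq0 // q2B1_neq0.
Qed.

Lemma g2_Omega2_torus : g2_Omega2 q torus_gen = beta%:S.
Proof.
rewrite rescaled_Omega2 // integral_Omega2_torus -rmorphM /b; congr _%:S.
have := q2B1_neq0 q_not_root_of_unity; have := q4Dq2D1_neq0 q_not_root_of_unity.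
by rewrite -/m -/d => d0 m0; field; rewrite d0 m0.
Qed.

Let ev_qx v : ev (qx v) = qmonom q 1 v.
Proof. by rewrite qeval_gen /keycoef !mulr1. Qed.

Lemma torus_gen1 : torus_gen 1 = qmonom q 1 (1, 0, 0, 0).
Proof. by rewrite /torus_gen /rescaled rmorph1 mul1r; apply: ev_qx. Qed.

Lemma scalar_qmonom (c c' : K) v : c%:S * qmonom q c' v = qmonom q (c * c') v.
Proof. by apply: op_ext => f w; rewrite /= !mulrA. Qed.

Lemma torus_gen2 : torus_gen 2 = qmonom q d^-1 (0, 1, 0, 0).
Proof.
have -> : torus_gen 2 = d^-1%:S * ev (qx (0, 1, 0, 0)) by [].
by rewrite ev_qx scalar_qmonom mulr1.
Qed.

(** The coefficient a of Omega_1 equals - d / m, so the left-hand side is u_3. *)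
Lemma torus_cluster3 :
  torus_gen 1 * torus_gen 3 - (d / m)%:S * torus_gen 2 =
  qmonom q m^-1 (0, 0, 1%R, 0).
Proof.
have E : integral_gen 1 * integral_gen 3 - integral_gen 2
    = ev (qx (0, 0, 1%R, 0)).
  by rewrite /integral_gen; torus_eq.
have d0 : d != 0 := q4Dq2D1_neq0 q_not_root_of_unity.
rewrite -[m^-1]mulr1 -scalar_qmonom -ev_qx -E /torus_gen /rescaled; cbn [nth].
rewrite scalarMM scalarA mulrBr mul1r; congr (_ - _%:S * _).
rewrite -/m -/d; have m0 : m != 0 := q2B1_neq0 q_not_root_of_unity.
by field; rewrite m0 d0.
Qed.

(** The coefficient b of Omega_2 equals - q^9 m / d^2, so the left-hand side is u_4. *)
Lemma torus_cluster4 :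
  torus_gen 2 * torus_gen 4 - (q ^+ 9 * m / d ^+ 2)%:S * torus_gen 3 ^+ 3 =
  qmonom q (m ^- 2 / d ^+ 2) (0, 0, 0, 1%R).
Proof.
have E : integral_gen 2 * integral_gen 4 - (q ^ 9)%:S * integral_gen 3 ^+ 3
    = ev (qx (0, 0, 0, 1%R)).
  by rewrite /integral_gen; torus_eq.
have d0 : d != 0 := q4Dq2D1_neq0 q_not_root_of_unity.
have m0 : m != 0 := q2B1_neq0 q_not_root_of_unity.
rewrite -[m ^- 2 / _]mulr1 -scalar_qmonom -ev_qx -E /torus_gen /rescaled.
cbn [nth].
rewrite scalarX scalarMM scalarA [RHS]mulrBr scalarA.
rewrite -/m -/d; congr (_%:S * _ - _%:S * _).
  by field; rewrite m0 d0.
by rewrite -[q ^ 9]/(q ^+ 9); field; rewrite m0 d0.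
Qed.

End TorusRepresentation.

(** * Independent monomials and the lower bound on growth *)

Section Representation.
Local Open Scope classical_set_scope.
Variables (K : fieldType) (q : K).
Hypothesis q_neq0 : q != 0.
Hypothesis q_not_root_of_unity : forall n : nat, (0 < n)%N -> q ^+ n != 1.
Variables alpha beta : K.
Local Notation A := (A_alg q alpha beta).
Local Notation e := (@A_gen K q alpha beta).
Local Notation T := (torus_gen q alpha beta).

(** A universal property is used three times: for the free algebra, for the quotient by the defining
    relations, and for the quotient by Omega_1 - alpha and Omega_2 - beta. *)
Lemma torus_representation : exists f : {rmorphism A -> op K},
  (forall c, f c%:S = c%:S) /\ (forall k, (0 < k < 7)%N -> f (e k) = T k).
Proof.
pose h (m : {fmonom 'I_6}) : op K := \prod_(i <- m) T i.+1.
have hM : mmorphism h.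
  split=> [m1 m2|]; rewrite /h; first by rewrite fmM big_cat.
  by rewrite fm1 big_nil.
pose H : {mmorphism {fmonom 'I_6} -> op K} :=
  HB.pack h (isMultiplicative.Build _ _ h hM).
pose f0 := mmap (@pzscalar K (op K)) H.
have f0M : monoid_morphism f0.
  have [? ?] : multiplicative f0.
    by apply: commr_mmap_is_multiplicative => g m m'; apply: pzscalarC.
  by split.
have f0B : zmod_morphism f0 by exact: mmapB.
pose F0 : {rmorphism {malg K[{fmonom 'I_6}]} -> op K} := HB.pack f0
  (GRing.isZmodMorphism.Build _ _ f0 f0B)
  (GRing.isMonoidMorphism.Build _ _ f0 f0M).
have F0S c : F0 c%:S = c%:S by exact: mmapC.
have F0e k : (0 < k < 7)%N -> F0 (free_gen K k) = T k.
  move=> /andP[k0 k7].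
  have -> : F0 (free_gen K k) = 1%:S * h (fmu (inord k.-1)) by exact: mmapU.
  by rewrite rmorph1 mul1r /h fmU big_seq1 inordK ?prednK // -ltnS prednK.
(* Only the indices 1 to 6 can be compared: at 0, [free_gen] gives E_1 whereas [torus_gen] gives
   0. *)
have relT e' : (forall k, (0 < k < 7)%N -> e' k = T k) ->
    g2_relations q e' = g2_relations q T.
  by move=> eE; rewrite /g2_relations !eE.
have OmegaT e' : (forall k, (0 < k < 7)%N -> e' k = T k) ->
    (g2_Omega1 q e' = alpha%:S) * (g2_Omega2 q e' = beta%:S).
  move=> eE; split.
    rewrite -(g2_Omega1_torus q_neq0 q_not_root_of_unity alpha beta).
    by rewrite /g2_Omega1 !eE.
  rewrite -(g2_Omega2_torus q_neq0 q_not_root_of_unity alpha beta).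
  by rewrite /g2_Omega2 !eE.
have [|f1 f1E] := @quotient_lift K _ (op K)
  [set r.1 - r.2 | r in [set` UqG2_relations q]] F0.
  move=> _ [r rR <-]; rewrite rmorphB; apply/eqP; rewrite subr_eq0; apply/eqP.
  apply: (@g2_relations_torus _ _ q_neq0 q_not_root_of_unity alpha beta
    (F0 r.1, F0 r.2)).
  rewrite -(relT (F0 \o @free_gen K)) // -map_g2_relations // -UqG2_relationsE.
  exact: (map_f (fun r => (F0 r.1, F0 r.2))).
have f1S c : f1 c%:S = c%:S by rewrite -F0S -f1E.
have f1e k : (0 < k < 7)%N -> (f1 \o UqG2_gen q) k = T k.
  by move=> kP; rewrite /= f1E F0e.
have [|f2 f2E] := @quotient_lift K _ (op K)
  [set Omega1 q - alpha%:S; Omega2 q - beta%:S] f1.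
  move=> _ [] ->; rewrite rmorphB f1S; apply/eqP; rewrite subr_eq0; apply/eqP.
    by rewrite -[RHS](OmegaT _ f1e).1 -(map_g2_Omega _ _ f1S).1.
  by rewrite -[RHS](OmegaT _ f1e).2 -(map_g2_Omega _ _ f1S).2.
exists f2; split=> [c|k kP]; first by rewrite -f1S -f2E.
by rewrite f2E -f1e.
Qed.

Lemma op_sumE (I : Type) (r : seq I) (F : I -> op K) g w :
  (\sum_(i <- r) F i) g w = \sum_(i <- r) F i g w.
Proof. by elim/big_rec2: _ => // i y x _ <-. Qed.

(** Applying a relation to the delta function at the j-th exponent and evaluating at the origin
    isolates the j-th coefficient, up to a nonzero factor. *)
Lemma qmonom_lin_indep (B : pzAlgType K) (f : {rmorphism B -> op K})
    (I : eqType) (r : seq I) (y : I -> B) (c : I -> K) (v : I -> lattice) :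
    (forall c, f c%:S = c%:S) -> uniq r -> injective v ->
    (forall i, c i != 0) -> (forall i, f (y i) = qmonom q (c i) (v i)) ->
  lin_indep (map y r).
Proof.
move=> fS r_uniq v_inj c0 fy d; rewrite size_map => d0 j ltj.
have x0 : I by case: r ltj {r_uniq d0} => // x.
pose delta (w : lattice) : K := (w == v (nth x0 r j))%:R.
have /(congr1 (fun x : op K => x delta 0)) := congr1 f d0.
rewrite rmorph0 rmorph_sum op_sumE (bigD1 (Ordinal ltj)) //= big1 => [|i ij].
  rewrite rmorphM fS (nth_map x0) // fy scalar_qmonom /= /delta add0r eqxx.
  rewrite addr0 mulr1.
  move/eqP; rewrite !mulf_eq0 (negPf (c0 _)) orbF => /orP[/eqP//|].
  by rewrite expfz_eq0 (negPf q_neq0) andbF.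
rewrite rmorphM fS (nth_map x0) // fy scalar_qmonom /= /delta add0r.
by rewrite (inj_eq v_inj) nth_uniq // (negPf (_ : i != j :> nat)) ?mulr0.
Qed.

Definition is_qmonom (x : op K) (v : lattice) : Prop :=
  exists2 c, c != 0 & x = qmonom q c v.

Lemma is_qmonomM x y u v :
  is_qmonom x u -> is_qmonom y v -> is_qmonom (x * y) (u + v).
Proof.
move=> [c c0 ->] [d d0 ->]; rewrite (qmonomM q_neq0).
by eexists; last by []; rewrite !mulf_neq0 // expfz_neq0.
Qed.

Lemma is_qmonomX x v n : is_qmonom x v -> is_qmonom (x ^+ n) (v *+ n).
Proof.
move=> xv; elim: n => [|n IHn]; last by rewrite exprS mulrS; apply: is_qmonomM.
by exists 1; rewrite ?oner_neq0 // expr0 mulr0n qmonom_scalar rmorph1.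
Qed.

Lemma rmorph_monomial4 (B C : pzRingType) (f : {rmorphism B -> C})
    x y z t a b c d :
  f (x ^+ a * y ^+ b * z ^+ c * t ^+ d) =
  f x ^+ a * f y ^+ b * f z ^+ c * f t ^+ d.
Proof. by rewrite !rmorphM !rmorphXn. Qed.

Lemma rmorph_binomial (B : pzAlgType K) (C : pzRingType)
    (f : {rmorphism B -> C}) x y z c n :
  f (x * y - c%:S * z ^+ n) = f x * f y - f c%:S * f z ^+ n.
Proof. by rewrite rmorphB !rmorphM rmorphXn. Qed.

Let m := q ^+ 2 - 1.
Let d := q ^+ 4 + q ^+ 2 + 1.

Definition cluster_gen (i : nat) : A :=
  nth 0 [:: e 1; e 2; e 1 * e 3 - (d / m)%:S * e 2;
            e 2 * e 4 - (q ^+ 9 * m / d ^+ 2)%:S * e 3 ^+ 3] i.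

Definition cluster_monomial (k : nat * nat * nat * nat) : A :=
  cluster_gen 0 ^+ k.1.1.1 * cluster_gen 1 ^+ k.1.1.2 * cluster_gen 2 ^+ k.1.2
  * cluster_gen 3 ^+ k.2.

Definition lattice_of (k : nat * nat * nat * nat) : lattice :=
  (k.1.1.1%:Z, k.1.1.2%:Z, k.1.2%:Z, k.2%:Z).

Lemma lattice_of_inj : injective lattice_of.
Proof. by move=> [[[a b] c] l] [[[a' b'] c'] l'] [-> -> -> ->]. Qed.

Lemma cluster_monomial_torus (f : {rmorphism A -> op K}) k :
    (forall c, f c%:S = c%:S) -> (forall k, (0 < k < 7)%N -> f (e k) = T k) ->
  is_qmonom (f (cluster_monomial k)) (lattice_of k).
Proof.
move=> fS fe; have m0 : m != 0 := q2B1_neq0 q_not_root_of_unity.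
have d0 : d != 0 := q4Dq2D1_neq0 q_not_root_of_unity.
have -> : lattice_of k = (1, 0, 0, 0) *+ k.1.1.1 + (0, 1, 0, 0) *+ k.1.1.2
    + (0, 0, 1%R, 0) *+ k.1.2 + (0, 0, 0, 1%R) *+ k.2.
  have mulrn4 (a b c l : int) n :
      (a, b, c, l) *+ n = (a *+ n, b *+ n, c *+ n, l *+ n) :> lattice.
    by elim: n => // n IHn; rewrite !mulrS IHn.
  rewrite !mulrn4 !mul0rn !natz.
  by congr (_, _, _, _); rewrite /= ?addr0 ?add0r.
rewrite /cluster_monomial rmorph_monomial4.
repeat apply: is_qmonomM; apply: is_qmonomX; rewrite /cluster_gen; cbn [nth].
- by rewrite fe // torus_gen1; exists 1; rewrite ?oner_neq0.
- by rewrite fe // torus_gen2; eexists; last by []; rewrite invr_eq0.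
- rewrite -[e 2]expr1 (rmorph_binomial f) expr1 (fS (d / m)).
  rewrite (fe 1 isT) (fe 2 isT) (fe 3 isT) torus_cluster3 //.
  by eexists; last by []; rewrite invr_eq0.
- rewrite (rmorph_binomial f) (fS (q ^+ 9 * m / d ^+ 2)).
  rewrite (fe 2 isT) (fe 3 isT) (fe 4 isT) torus_cluster4 //.
  by eexists; last by []; rewrite mulf_neq0 ?invr_eq0 ?expf_neq0.
Qed.

Definition cluster_space : set A :=
  lin_span [set` [seq cluster_gen i | i <- iota 0 4]].

Lemma cluster_spaceP i : (i < 4)%N -> cluster_space (cluster_gen i).
Proof. by move=> lti; apply: sub_lin_span; apply: map_f; rewrite mem_iota. Qed.

Lemma subspace_powX (V : set A) x y i j :
  subspace_pow V i x -> V y -> subspace_pow V (i + j) (x * y ^+ j).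
Proof.
move=> ix Vy; elim: j => [|j IHj]; first by rewrite addn0 expr0 mulr1.
rewrite addnS exprSr mulrA /=; apply: sub_lin_span.
by exists (x * y ^+ j) => //; exists y.
Qed.

Lemma cluster_monomial_growth n k : (k.1.1.1 + k.1.1.2 + k.1.2 + k.2 <= n)%N ->
  growth_space cluster_space n (cluster_monomial k).
Proof.
move=> lekn; apply: sub_lin_span.
exists (k.1.1.1 + k.1.1.2 + k.1.2 + k.2)%N => //.
have pow0 : subspace_pow cluster_space 0 1 by apply: sub_lin_span.
have pow1 := subspace_powX k.1.1.1 pow0 (cluster_spaceP (isT : (0 < 4)%N)).
rewrite add0n mul1r in pow1.
have pow2 := subspace_powX k.1.1.2 pow1 (cluster_spaceP (isT : (1 < 4)%N)).
have pow3 := subspace_powX k.1.2 pow2 (cluster_spaceP (isT : (2 < 4)%N)).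
exact: subspace_powX k.2 pow3 (cluster_spaceP (isT : (3 < 4)%N)).
Qed.

(** Monomials with all four exponents at most N have total degree at most 4 N, and their images are
    nonzero multiples of distinct x^v. *)
Lemma growth_cluster_space N n : (4 * N <= n)%N ->
  (N.+1 ^ 4 <= growth cluster_space n)%N.
Proof.
move=> leNn; have [f [fS fe]] := torus_representation.
pose I : finType := ('I_N.+1 * 'I_N.+1 * 'I_N.+1 * 'I_N.+1)%type.
pose k (i : I) : nat * nat * nat * nat :=
  (i.1.1.1 : nat, i.1.1.2 : nat, i.1.2 : nat, i.2 : nat).
have k_inj : injective k.
  move=> [[[a b] c] l] [[[a' b'] c'] l'] [].
  by do 4 move=> /val_inj->.
have /choice[c cP] (i : I) : exists c, c != 0 /\
    f (cluster_monomial (k i)) = qmonom q c (lattice_of (k i)).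
  by have [c c0 cE] := cluster_monomial_torus (k i) fS fe; exists c.
pose Y := [seq cluster_monomial (k i) | i <- enum I].
have <- : size Y = (N.+1 ^ 4)%N.
  by rewrite size_map -cardE !card_prod !card_ord !expnS expn0 muln1 !mulnA.
apply: (growth_ge q_neq0 (@A_genP K q alpha beta) (@A_Omega1 _ _ _ _)
  (@A_Omega2 _ _ _ _) (@A_gen_below _ _ _ _)).
- by exists [seq cluster_gen i | i <- iota 0 4].
- apply: (qmonom_lin_indep (c := c) (v := lattice_of \o k) fS).
  + exact: enum_uniq.
  + by move=> i j /lattice_of_inj/k_inj.
  + by move=> i; case: (cP i).
  + by move=> i; case: (cP i).
- move=> _ /mapP[i _ ->]; apply: cluster_monomial_growth => /=.
  case: i => [[[i1 i2] i3] i4] /=; apply: leq_trans leNn.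
  rewrite (_ : 4 * N = N + N + N + N)%N; last by lia.
  by rewrite !leq_add // -ltnS ltn_ord.
Qed.

End Representation.

(** * The Gelfand-Kirillov dimension *)

Theorem proposition4p2 (R : realType) (K : fieldType) (q : K)
    (q_neq0 : q != 0)
    (q_not_root_of_unity : forall n : nat, (0 < n)%N -> q ^+ n != 1)
    (alpha beta : K) (alpha_beta_neq0 : (alpha, beta) != (0, 0)) :
  GKdim R (A_alg q alpha beta) = 4%:E.
Proof.
apply/eqP; rewrite eq_le; apply/andP; split.
  apply: ge_ereal_sup => _ [V Vfin <-].
  have [m Vm] := growth_le q_neq0 (@A_genP K q alpha beta) (@A_Omega1 _ _ _ _)
    (@A_Omega2 _ _ _ _) (@A_gen_below _ _ _ _) Vfin.
  (* For n > 0, m n + 1 <= (m + 1) n, which turns the bound 9 (m n + 1)^4 into a constant times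
     n^4. *)
  apply: (@limn_esup_growth_le _ _ 4 (9 * m.+1 ^ 4)).
    by rewrite muln_gt0 expn_gt0.
  move=> n n_gt0; apply: leq_trans (Vm n) _.
  rewrite -mulnA leq_mul2l /= -expnMn leq_exp2r //.
  by rewrite mulSn addnC -addn1 leq_add2l.
apply: le_trans (ereal_sup_ubound _); last first.
  exists (@cluster_space K q alpha beta) => //.
  by exists [seq @cluster_gen K q alpha beta i | i <- iota 0 4].
(* With N = n div 4, n <= 4 (N + 1), so n^4 <= 4^4 (N + 1)^4. *)
apply: (@limn_esup_growth_ge _ _ 4 (4 ^ 4)) => // n _.
have le4n : (4 * (n %/ 4) <= n)%N by rewrite mulnC leq_divM.
have := growth_cluster_space q_neq0 q_not_root_of_unity alpha beta le4n.
rewrite -(leq_pmul2l (isT : 0 < 4 ^ 4)%N); apply: leq_trans.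
by rewrite -expnMn leq_exp2r // mulnC ltnW // ltn_ceil.
Qed.
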